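(* For $M\in\{\mathbb N,\mathbb Z\}$, conjugacy of finitely presented $M$-systems is semidecidable: there is an algorithm which, given two finitely presented $M$-systems (each given by a presentation $(Y:Z)$), halts if and only if the two systems are conjugate.
   Context: A dynamical $M$-system is an action of $M$ by continuous maps on a compact metrizable space. Two systems are conjugate if there is an equivariant homeomorphism between them. A subshift over $M$ is a closed shift-invariant subset of $\Sigma^M$, $\Sigma$ a finite alphabet; it is an SFT if it is defined by a finite set of forbidden words. $(\Sigma^2)^M$ is identified with $\Sigma^M\times\Sigma^M$. A finitely presented system (SFT/SFT) is one conjugate to $Y/Z$ for some SFTs $Y\subset\Sigma^M$, $Z\subset(\Sigma^2)^M$ such that $Z\cap Y^2$ is an equivalence relation on $Y$, where $Y/Z$ is the topological quotient $Y/(Z\cap Y^2)$ with the induced shift action. A presentation $(Y:Z)$ is given to an algorithm as a pair of finite lists of forbidden words defining $Y$ and $Z$. *)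

(* Defs.v *)
From HB Require Import structures.
From mathcomp Require Import all_boot all_order all_algebra.
From mathcomp Require Import all_classical topology function_spaces.

Set Implicit Arguments.
Unset Strict Implicit.
Unset Printing Implicit Defensive.

Import GRing.Theory.
Local Open Scope classical_set_scope.
Local Open Scope ring_scope.
Local Open Scope quotient_scope.

(* Kleene's partial recursive functions, with untyped arities. The recursion
   variable of [RRec] and the search variable of [RMin] come first. *)
Inductive recfun : Type :=
| RZero
| RSucc
| RProj of nat
| RComp of recfun & seq recfun
| RRec of recfun & recfun
| RMin of recfun.

Inductive computes : recfun -> seq nat -> nat -> Prop :=
| computes_zero v : computes RZero v 0%N
| computes_succ n v : computes RSucc (n :: v) n.+1
| computes_proj i v : (i < size v)%N -> computes (RProj i) v (nth 0%N v i)
| computes_comp f gs v ws y :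
    size ws = size gs ->
    (forall i, (i < size gs)%N ->
       computes (nth RZero gs i) v (nth 0%N ws i)) ->
    computes f ws y ->
    computes (RComp f gs) v y
| computes_rec0 f g v y :
    computes f v y -> computes (RRec f g) (0%N :: v) y
| computes_recS f g n v r y :
    computes (RRec f g) (n :: v) r -> computes g [:: n, r & v] y ->
    computes (RRec f g) (n.+1 :: v) y
| computes_min f v n (k : nat -> nat) :
    (forall m, (m < n)%N -> computes f (m :: v) (k m).+1) ->
    computes f (n :: v) 0%N ->
    computes (RMin f) v n.

Definition halts (e : recfun) (v : seq nat) : Prop :=
  exists y, computes e v y.

(* Compactness and metrizability are not fields: they hold for every quotient
   [Y/Z] below (the quotient of a compact metrizable space by a closed
   equivalence relation), hence for every system conjugate to one. *)
Record msystem (M : nmodType) := MSystem {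
  points :> topologicalType;
  act : M -> points -> points;
  act0 : forall x, act 0 x = x;
  actD : forall m n x, act (m + n) x = act m (act n x);
  act_continuous : forall m, continuous (act m) }.

Definition conjugate (M : nmodType) (X Y : msystem M) : Prop :=
  exists (f : X -> Y) (g : Y -> X),
    [/\ cancel f g, cancel g f, continuous f, continuous g &
        forall m x, f (act m x) = act m (f x)].

(* The space [A^M] of configurations, with the product topology. *)
Notation config M A := {ptws M -> discrete_topology A}.

Section Shifts.
Variables (M : pzSemiRingType) (A : finType).
Implicit Types (m i : M) (x y : config M A).

Definition shift m x : config M A := fun i => x (m + i).

(* The word of length [n] read in [x] from position [i]. *)
Definition subword x i (n : nat) : seq A := [seq x (i + j%:R) | j <- iota 0 n].

Definition sft (F : seq (seq A)) : set (config M A) :=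
  [set x | forall w, w \in F -> forall i, subword x i (size w) <> w].

Lemma sft_shift F m x : sft F x -> sft F (shift m x).
Proof.
move=> Fx w wF i; rewrite (_ : subword _ i _ = subword x (m + i) (size w)).
  exact: Fx.
by apply: eq_map => j; rewrite /shift addrA.
Qed.

Lemma shift_continuous m : continuous (shift m).
Proof.
move=> x; have FF : Filter (shift m @ x)
  by apply: (fmap_filter (shift m) (nbhs_filter x)).
apply/cvg_sup => i.
apply: (@continuous_comp_initial _ (config M A) (discrete_topology A)
  (fun y : config M A => y i)) => y.
exact: (@proj_continuous M (fun=> discrete_topology A) (m + i)).
Qed.

End Shifts.

Arguments sft_shift {M A F} m {x} _.

Section Presentations.
Variable M : pzSemiRingType.

(* The relation [Z `&` Y^2] on the SFT [Y], under the identification of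
   [(A * A)^M] with [A^M * A^M]; [F] defines [Y] and [G] defines [Z]. *)
Definition sft_rel (A : finType) (F : seq (seq A)) (G : seq (seq (A * A)))
    (x y : set_type (@sft M A F)) : bool :=
  `[< @sft M (A * A)%type G (fun i => (val x i, val y i)) >].

(* Any finite alphabet may be renamed to [{0, ..., alph - 1}]; the last three
   fields say that [Z `&` Y^2] is an equivalence relation on [Y]. *)
Record presentation := Presentation {
  alph : nat;
  forbY : seq (seq 'I_alph);
  forbZ : seq (seq ('I_alph * 'I_alph));
  sft_rel_refl : reflexive (@sft_rel _ forbY forbZ);
  sft_rel_sym : symmetric (@sft_rel _ forbY forbZ);
  sft_rel_trans : transitive (@sft_rel _ forbY forbZ) }.

Variable P : presentation.

Definition Yspace : topologicalType := set_type (@sft M 'I_(alph P) (forbY P)).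

Definition Yshift (m : M) (y : Yspace) : Yspace :=
  exist _ (shift m (val y)) (mem_set (sft_shift m (set_mem (valP y)))).

Definition Zrel : equiv_rel Yspace :=
  EquivRel (@sft_rel _ (forbY P) (forbZ P))
    (@sft_rel_refl P) (@sft_rel_sym P) (@sft_rel_trans P).

Definition YmodZ : topologicalType := quotient_topology {eq_quot Zrel}.

Definition class_of (y : Yspace) : YmodZ := \pi_({eq_quot Zrel}) y.

Definition YmodZ_shift (m : M) (c : YmodZ) : YmodZ :=
  class_of (Yshift m (repr (c : {eq_quot Zrel}))).

Lemma YmodZ_shiftE m y : YmodZ_shift m (class_of y) = class_of (Yshift m y).
Proof.
apply/eqmodP => /=; apply/asboolP.
have : Zrel (repr (\pi_({eq_quot Zrel}) y)) y by apply/eqmodP; rewrite reprK.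
by move=> /asboolP /(sft_shift m).
Qed.

Lemma class_of_surj c : exists y, class_of y = c.
Proof. by exists (repr (c : {eq_quot Zrel})); exact: reprK. Qed.

Lemma YmodZ_shift0 c : YmodZ_shift 0 c = c.
Proof.
have [y <-] := class_of_surj c; rewrite YmodZ_shiftE; congr class_of.
by apply/val_inj/funext => i; rewrite /= /shift add0r.
Qed.

Lemma YmodZ_shiftD m n c :
  YmodZ_shift (m + n) c = YmodZ_shift m (YmodZ_shift n c).
Proof.
have [y <-] := class_of_surj c; rewrite !YmodZ_shiftE; congr class_of.
by apply/val_inj/funext => i; rewrite /= /shift addrA (addrC n).
Qed.

Lemma Yshift_continuous m : continuous (Yshift m).
Proof.
apply: (@continuous_comp_initial _ Yspace (config M 'I_(alph P)) set_val) => y.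
apply: (@continuous_comp Yspace (config M 'I_(alph P)) _ set_val (shift m)).
  exact: initial_continuous.
exact: shift_continuous.
Qed.

Lemma YmodZ_shift_continuous m : continuous (YmodZ_shift m).
Proof.
apply/(@quotient_continuous Yspace {eq_quot Zrel}).
rewrite (_ : _ \o _ = class_of \o Yshift m); last first.
  by apply/funext => y; exact: YmodZ_shiftE.
move=> y; apply: continuous_comp; first exact: Yshift_continuous.
exact: (@pi_continuous Yspace {eq_quot Zrel}).
Qed.

Definition system_of : msystem M :=
  MSystem YmodZ_shift0 YmodZ_shiftD YmodZ_shift_continuous.

End Presentations.

(* The input handed to the algorithm: Goedel numbers of the lists of forbidden
   words. The proof fields of a presentation are not part of its code. *)
Section Codes.
Variables (M : pzSemiRingType) (P : presentation M).

Definition code_word (w : seq 'I_(alph P)) : nat :=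
  CodeSeq.code [seq val a | a <- w].

Definition code_word2 (w : seq ('I_(alph P) * 'I_(alph P))) : nat :=
  CodeSeq.code [seq CodeSeq.code [:: val ab.1; val ab.2] | ab <- w].

Definition code_presentation : nat :=
  CodeSeq.code [:: alph P;
    CodeSeq.code [seq code_word w | w <- forbY P];
    CodeSeq.code [seq code_word2 w | w <- forbZ P]].

End Codes.

(* Main.v *)
Require Import Defs.
From mathcomp Require Import all_boot all_order all_algebra.
From mathcomp Require Import all_classical topology function_spaces.
From mathcomp Require Import zify.

Set Implicit Arguments.
Unset Strict Implicit.
Unset Printing Implicit Defensive.

(** Let [h] be a conjugacy from [Y1/Z1] to [Y2/Z2], and let [W] be the set of
    the pairs [(y1, y2)] in [Y1 * Y2] with [h [y1] = [y2]]. It is closed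
    ([graph_closed]) and shift-invariant. It is even defined by finitely many
    forbidden words ([relation_sft]): the second system is expansive, as [y2] and
    [y2'] are equivalent once no forbidden pair is seen anywhere, so a point
    [(y1, y2)] that everywhere looks locally like a point of [W] is in [W].
    Conversely, a subshift of finite type [W] in [Y1 * Y2] comes from a conjugacy
    as soon as both projections are onto, and [y1], [y1'] are equivalent if and
    only if [y2], [y2'] are, for all [(y1, y2)] and [(y1', y2')] in [W]
    ([relation_conjugate]). An algorithm can therefore search for the forbidden
    words of [W], provided that these conditions are semidecidable.

    The condition on the equivalence relations is an inclusion between subshifts
    of finite type. By compactness it holds if and only if it can be read off the
    admissible words of some length ([compatible]).

    Surjectivity of [W -> Y1] means that every word [u] of [Y1] has a lift in [W].
    Let [k] bound the lengths of all forbidden words. What matters of [u] for the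
    lifts of its extensions is its type: its last [k] letters and the set of the
    last [k] letters of its lifts. There are finitely many types, so for some [N]
    all types of words of length at least [k] occur for lengths between [k] and
    [N]; then every word of length [N + 1] has the type of a shorter word. If
    moreover all words of length between [k] and [N] have lifts, then so have all
    words, because a word can be shortened each time that its length exceeds [N]
    ([total_simulates]). Membership of a word in the language of [Y1] is
    approximated by the existence of extensions by [m] letters ([total]).

    All these conditions are bounded quantifications over words, so the
    certificate is checked by a primitive recursive function ([recb_check]), and
    unbounded search for a certificate is the required algorithm. Limits of words
    and of configurations are taken along a free ultrafilter on the natural
    numbers. The two monoids are treated at once by means of exhausting windows
    ([windows]). *)

(** * Computable functions *)

Lemma computes_fun e v y y' : computes e v y -> computes e v y' -> y = y'.
Proof.
move=> H; elim: H y' => {e v y}.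
- by move=> v y' H; inversion H.
- by move=> n v y' H; inversion H.
- by move=> i v _ y' H; inversion H.
- move=> f gs v ws y szw _ IHgs _ IHf y' H.
  inversion H as [| | |f' gs' v' ws' z szw' Hgs Hf| | |]; subst.
  have E : ws = ws'; last by subst; exact: IHf.
  apply: (@eq_from_nth _ 0) => [|i ltiw]; first by rewrite szw.
  by apply: IHgs; [rewrite -szw | apply: Hgs; rewrite -szw].
- move=> f g v y _ IH y' H.
  by inversion H as [| | | |f' g' v' z Hf| |]; subst; exact: IH.
- move=> f g n v r y _ IHr _ IHy y' H.
  inversion H as [| | | | |f' g' n' v' r' z Hr Hy|]; subst.
  by have E := IHr _ Hr; subst; exact: IHy.
- move=> f v n k H1 IH1 _ IH2 y' H.
  inversion H as [| | | | | |f' v' n' k' H1' H2']; subst.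
  case: (ltngtP n y') => // ltn.
  + by have := IH2 _ (H1' _ ltn).
  + by have := IH1 _ ltn _ H2'.
Qed.

(** [f] is computable on the vectors of length [k]; the length is the only part
    of the environment [v] that a program may rely on. *)
Definition recn k (f : seq nat -> nat) :=
  exists e, forall v, size v = k -> computes e v (f v).

(** The decidable predicates on the vectors of length [k]. *)
Definition recb k (p : seq nat -> bool) := recn k (fun v => nat_of_bool (p v)).

Lemma recn_ext k f g : recn k f -> (forall v, f v = g v) -> recn k g.
Proof. by case=> e He E; exists e => v sv; rewrite -E; exact: He. Qed.

Lemma recn_zero k : recn k (fun=> 0).
Proof. by exists RZero => v _; constructor. Qed.

Lemma recn_nth k i : i < k -> recn k (fun v => nth 0 v i).
Proof. by move=> ltik; exists (RProj i) => v sv; constructor; rewrite sv. Qed.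

Lemma recn_head k : recn k.+1 (head 0).
Proof. by apply: recn_ext (@recn_nth k.+1 0 isT) _ => v; exact: nth0. Qed.

(** Composition, with the programs of the arguments given as a list. *)
Lemma recn_comp k j (gs : seq (seq nat -> nat)) f :
  size gs = j -> recn j f -> (forall i, i < j -> recn k (nth (fun=> 0) gs i)) ->
  recn k (fun v => f [seq g v | g <- gs]).
Proof.
move=> sgs [e He] Hgs.
have {}Hgs : exists es, size es = j /\ forall i, i < j -> forall v, size v = k ->
    computes (nth RZero es i) v (nth (fun=> 0) gs i v).
  elim: gs j sgs Hgs {e He f} => [|g gs IH] [|j] //= => [_ _|[sgs] Hgs].
    by exists [::].
  have [es [ses Hes]] := IH j sgs (fun i => Hgs i.+1).
  have [e He] := Hgs 0 isT.
  by exists (e :: es); rewrite /= ses; split=> // -[|i] //; exact: Hes.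
case: Hgs => es [ses Hes]; exists (RComp e es) => v sv.
apply: (@computes_comp _ _ _ [seq g v | g <- gs]).
- by rewrite size_map sgs.
- move=> i; rewrite ses => lti.
  by rewrite (nth_map (fun=> 0)) ?sgs //; exact: Hes.
- by apply: He; rewrite size_map.
Qed.

(** Composition with a function [g] between vectors. *)
Lemma recn_subst k j f g : recn j f -> (forall v, size v = k -> size (g v) = j) ->
  (forall i, i < j -> recn k (fun v => nth 0 (g v) i)) -> recn k (fun v => f (g v)).
Proof.
move=> Hf sg Hg.
have [||e He] := @recn_comp k j [seq (fun v => nth 0 (g v) i) | i <- iota 0 j] f _ Hf.
- by rewrite size_map size_iota.
- move=> i lti; rewrite (nth_map 0) ?size_iota // nth_iota //; exact: Hg.
exists e => v sv; have := He v sv; rewrite -map_comp.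
by rewrite (_ : map _ _ = g v) // -[RHS](mkseq_nth 0) sg.
Qed.

(** Weakening: a computable function may ignore a new first variable. *)
Lemma recn_behead k f : recn k f -> recn k.+1 (fun v => f (behead v)).
Proof.
move=> Hf; apply: (recn_subst Hf) => [v|i lti]; first by rewrite size_behead => ->.
by apply: recn_ext (@recn_nth k.+1 i.+1 lti) _ => v; rewrite nth_behead.
Qed.

Lemma recn_succ k f : recn k f -> recn k (fun v => (f v).+1).
Proof.
move=> Hf.
apply: (@recn_subst k 1 (fun v => (head 0 v).+1) (fun v => [:: f v])) => //.
- by exists RSucc => -[|a []] // _; constructor.
- by case=> // _.
Qed.

Lemma recn_const k c : recn k (fun=> c).
Proof. by elim: c => [|c IH]; [exact: recn_zero | exact: recn_succ IH]. Qed.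

(** Primitive recursion; the index and the previous value are the first two
    variables of the step [g]. *)
Lemma recn_iteri k n c (g : nat -> nat -> seq nat -> nat) :
  recn k n -> recn k c ->
  recn k.+2 (fun v => g (head 0 v) (head 0 (behead v)) (behead (behead v))) ->
  recn k (fun v => iteri (n v) (fun i x => g i x v) (c v)).
Proof.
move=> Hn [ec Hc] [eg Hg].
apply: (@recn_subst k k.+1
  (fun v => iteri (head 0 v) (fun i x => g i x (behead v)) (c (behead v)))
  (fun v => n v :: v)) => [|v /= ->|[|i] lti] //; last exact: (@recn_nth k i lti).
exists (RRec ec eg) => -[//|m v] [sv] /=.
elim: m => [|m IH] /=; first by constructor; exact: Hc.
by apply: computes_recS IH _; apply: (Hg [:: _, _ & v]); rewrite /= sv.
Qed.

Lemma recn_iter k n c (g : nat -> seq nat -> nat) :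
  recn k n -> recn k c ->
  recn k.+2 (fun v => g (head 0 (behead v)) (behead (behead v))) ->
  recn k (fun v => iter (n v) (fun x => g x v) (c v)).
Proof.
move=> Hn Hc Hg; apply: recn_ext (@recn_iteri k n c (fun _ => g) Hn Hc Hg) _ => v.
by elim: (n v) => //= m ->.
Qed.

Lemma recb_ext k p q : recb k p -> (forall v, p v = q v) -> recb k q.
Proof. by move=> Hp E; apply: recn_ext Hp _ => v; rewrite E. Qed.

Lemma recb_behead k p : recb k p -> recb k.+1 (fun v => p (behead v)).
Proof. exact: (@recn_behead k (fun v => nat_of_bool (p v))). Qed.

(** Removes one of the weakenings above a hypothesis of the context; binders
    are nested below to bounded depth. *)
Ltac weaken :=
  lazymatch goal with
  | |- recn _ (fun v => ?F (behead (behead (behead (behead (behead (behead v))))))) =>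
    refine (@recn_behead _ (fun v => F (behead (behead (behead (behead (behead v)))))) _)
  | |- recn _ (fun v => ?F (behead (behead (behead (behead (behead v)))))) =>
    refine (@recn_behead _ (fun v => F (behead (behead (behead (behead v))))) _)
  | |- recn _ (fun v => ?F (behead (behead (behead (behead v))))) =>
    refine (@recn_behead _ (fun v => F (behead (behead (behead v)))) _)
  | |- recn _ (fun v => ?F (behead (behead (behead v)))) =>
    refine (@recn_behead _ (fun v => F (behead (behead v))) _)
  | |- recn _ (fun v => ?F (behead (behead v))) =>
    refine (@recn_behead _ (fun v => F (behead v)) _)
  | |- recn _ (fun v => ?F (behead v)) => refine (@recn_behead _ F _)
  | |- recb _ (fun v => ?F (behead (behead (behead v)))) =>
    refine (@recb_behead _ (fun v => F (behead (behead v))) _)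
  | |- recb _ (fun v => ?F (behead (behead v))) =>
    refine (@recb_behead _ (fun v => F (behead v)) _)
  | |- recb _ (fun v => ?F (behead v)) => refine (@recb_behead _ F _)
  end.

(** The tactic [rec] proves computability by following the syntax of a function;
    bound variables are the first variables of the environment. *)
Create HintDb rec.
#[local] Hint Resolve recn_const recn_head recn_succ : rec.
#[local] Hint Extern 3 (recn _ _) => weaken : rec.
#[local] Hint Extern 3 (recb _ _) => weaken : rec.
Ltac rec := cbv beta; by auto 30 with rec nocore.

Lemma recn_add k f g : recn k f -> recn k g -> recn k (fun v => f v + g v).
Proof.
move=> Hf Hg; have := @recn_iter k f g (fun x _ => x.+1) Hf Hg ltac:(rec).
by move/recn_ext; apply=> v; elim: (f v) => //= n ->.
Qed.

Lemma recn_pred k f : recn k f -> recn k (fun v => (f v).-1).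
Proof.
move=> Hf; have := @recn_iteri k f _ (fun i _ _ => i) Hf (recn_const k 0) ltac:(rec).
by move/recn_ext; apply=> v; case: (f v).
Qed.

#[local] Hint Resolve recn_add recn_pred : rec.

Lemma recn_sub k f g : recn k f -> recn k g -> recn k (fun v => f v - g v).
Proof.
move=> Hf Hg; have := @recn_iter k g f (fun x _ => x.-1) Hg Hf ltac:(rec).
by move/recn_ext; apply=> v; elim: (g v) => [|n /= ->]; [rewrite subn0|rewrite subnS].
Qed.

Lemma recn_mul k f g : recn k f -> recn k g -> recn k (fun v => f v * g v).
Proof.
move=> Hf Hg.
have := @recn_iter k f _ (fun x v => g v + x) Hf (recn_const k 0) ltac:(rec).
by move/recn_ext; apply=> v; elim: (f v) => //= n ->; rewrite mulSn.
Qed.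

Lemma recb_pos k f : recn k f -> recb k (fun v => 0 < f v).
Proof.
move=> Hf; have := @recn_iter k f _ (fun _ _ => 1) Hf (recn_const k 0) ltac:(rec).
by move/recn_ext; apply=> v; case: (f v).
Qed.

#[local] Hint Resolve recn_sub recn_mul recb_pos : rec.

Lemma recn_exp k f g : recn k f -> recn k g -> recn k (fun v => f v ^ g v).
Proof.
move=> Hf Hg.
have := @recn_iter k g _ (fun x v => f v * x) Hg (recn_const k 1) ltac:(rec).
by move/recn_ext; apply=> v; elim: (g v) => //= n ->; rewrite expnS.
Qed.

Lemma recn_double k f : recn k f -> recn k (fun v => (f v).*2).
Proof.
move=> Hf; have : recn k (fun v => f v + f v) by rec.
by move/recn_ext; apply=> v; rewrite addnn.
Qed.

Lemma recb_ltn k f g : recn k f -> recn k g -> recb k (fun v => f v < g v).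
Proof.
move=> Hf Hg; have : recb k (fun v => 0 < g v - f v) by rec.
by move/recb_ext; apply=> v; rewrite subn_gt0.
Qed.

Lemma recb_not k p : recb k p -> recb k (fun v => ~~ p v).
Proof.
move=> Hp; have : recn k (fun v => 1 - p v) by apply: recn_sub; rec.
by move/recn_ext; apply=> v; case: (p v).
Qed.

Lemma recb_and k p q : recb k p -> recb k q -> recb k (fun v => p v && q v).
Proof.
move=> Hp Hq; have : recn k (fun v => p v * q v) by exact: recn_mul.
by move/recn_ext; apply=> v; case: (p v); case: (q v).
Qed.

Lemma recn_if k p f g : recb k p -> recn k f -> recn k g ->
  recn k (fun v => if p v then f v else g v).
Proof.
move=> Hp Hf Hg.
have : recn k (fun v => p v * f v + (1 - p v) * g v).
  by apply: recn_add; apply: recn_mul => //; apply: recn_sub; rec.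
by move/recn_ext; apply=> v; case: (p v); rewrite ?mul1n ?mul0n ?addn0.
Qed.

#[local] Hint Resolve recn_exp recn_double recb_ltn recb_not recb_and recn_if : rec.

Lemma recb_leq k f g : recn k f -> recn k g -> recb k (fun v => f v <= g v).
Proof. by move=> Hf Hg; apply: (@recb_ltn _ f (fun v => (g v).+1)); rec. Qed.

Lemma recb_imply k p q : recb k p -> recb k q -> recb k (fun v => p v ==> q v).
Proof.
move=> Hp Hq; have : recb k (fun v => ~~ (p v && ~~ q v)) by rec.
by move/recb_ext; apply=> v; rewrite negb_and negbK implybE.
Qed.

(** Bounded search, from which the bounded quantifiers follow. *)
Lemma recn_find k n (p : nat -> seq nat -> bool) :
  recn k n -> recb k.+1 (fun v => p (head 0 v) (behead v)) ->
  recn k (fun v => find (fun i => p i v) (iota 0 (n v))).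
Proof.
move=> Hn Hp.
pose step i x v := if x < i then x else if p i v then i else i.+1.
have Hp' : recb k.+2 (fun v => p (head 0 v) (behead (behead v))).
  apply: (@recn_subst _ k.+1 (fun v => nat_of_bool (p (head 0 v) (behead v)))
     (fun v => head 0 v :: behead (behead v))) => // [[|x[|y v]] //|[|i] lti].
  - by move=> /= [->].
  - exact: recn_head.
  - apply: (@recn_ext _ (fun v => nth 0 v i.+2)); first exact: (@recn_nth k.+2 i.+2).
    by move=> v; rewrite /= !nth_behead.
have := @recn_iteri k n _ step Hn (recn_const k 0) _.
move=> H; apply: (recn_ext (H _)) => [|v]; first by rewrite /step; rec.
elim: (n v) => // m IH; rewrite -addn1 iotaD find_cat size_iota /= addn1 /=.
rewrite {}IH /step add0n has_find size_iota.
have := find_size (p^~ v) (iota 0 m); rewrite size_iota leq_eqVlt => /orP[/eqP->|->//].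
by rewrite ltnn; case: (p m v); rewrite ?addn0 ?addn1.
Qed.

#[local] Hint Resolve recb_leq recb_imply recn_find : rec.

Lemma recb_eq k f g : recn k f -> recn k g -> recb k (fun v => f v == g v).
Proof.
move=> Hf Hg; have : recb k (fun v => (f v <= g v) && (g v <= f v)) by rec.
by move/recb_ext; apply=> v; rewrite eqn_leq.
Qed.

Lemma recb_has k n (p : nat -> seq nat -> bool) :
  recn k n -> recb k.+1 (fun v => p (head 0 v) (behead v)) ->
  recb k (fun v => has (fun i => p i v) (iota 0 (n v))).
Proof.
move=> Hn Hp; have : recb k (fun v => find (fun i => p i v) (iota 0 (n v)) < n v) by rec.
by move/recb_ext; apply=> v; rewrite has_find size_iota.
Qed.

Lemma recb_all k n (p : nat -> seq nat -> bool) :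
  recn k n -> recb k.+1 (fun v => p (head 0 v) (behead v)) ->
  recb k (fun v => all (fun i => p i v) (iota 0 (n v))).
Proof.
move=> Hn Hp; have : recb k (fun v => ~~ has (fun i => ~~ p i v) (iota 0 (n v))).
  by apply: recb_not; apply: (@recb_has k n (fun i v => ~~ p i v)); rec.
by move/recb_ext; apply=> v; rewrite -all_predC; apply: eq_all => i /=; rewrite negbK.
Qed.

#[local] Hint Resolve recb_eq recb_has recb_all : rec.
#[local] Hint Extern 2 (recn _ (fun v => nth 0 v _)) =>
  apply recn_nth; reflexivity : rec.

(** * Finite sequences and their codes *)

(** A nonempty sequence has the code [2 ^ a * (2 * t + 1)], where [a] is its head
    and [t] the code of its tail; head and tail are found by bounded search. *)

(** The [i]-th letter of the sequence with code [c], and 0 past its end. *)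
Definition letter (c i : nat) : nat := nth 0 (CodeSeq.decode c) i.

Lemma find_iota n (P : pred nat) x : x <= n -> (x < n -> P x) ->
  (forall y, y < x -> ~~ P y) -> find P (iota 0 n) = x.
Proof.
move=> lexn Px Py; rewrite -(subnKC lexn) iotaD find_cat add0n.
rewrite ifN ?size_iota; last first.
  by apply/hasPn => y; rewrite mem_iota => /andP[_]; exact: Py.
case: (n - x) (subn_gt0 x n) => [|m] /=; first by rewrite addn0.
by move=> /esym /Px ->; rewrite addn0.
Qed.

Lemma decode_cons a t : CodeSeq.decode (2 ^ a * t.*2.+1) = a :: CodeSeq.decode t.
Proof.
by rewrite -(CodeSeq.codeK (a :: CodeSeq.decode t)) /= CodeSeq.decodeK.
Qed.

Lemma decode_nil c : (CodeSeq.decode c == [::]) = (c == 0).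
Proof.
by rewrite -(can_eq CodeSeq.decodeK c 0) -(can_eq CodeSeq.codeK _ [::]).
Qed.

Lemma decodeP c a s : CodeSeq.decode c = a :: s ->
  [/\ c = 2 ^ a * (CodeSeq.code s).*2.+1, a < c & CodeSeq.code s < c].
Proof.
move=> E; have -> : c = CodeSeq.code (a :: s) by rewrite -E CodeSeq.decodeK.
split=> //; first by have /andP[] := CodeSeq.ltn_code (a :: s).
rewrite /=; have : 0 < 2 ^ a by rewrite expn_gt0.
by nia.
Qed.

Lemma size_decode c : size (CodeSeq.decode c) <= c.
Proof.
rewrite -{2}(CodeSeq.decodeK c); elim: (CodeSeq.decode c) => //= a s IH.
apply: leq_ltn_trans IH _; have : 0 < 2 ^ a by rewrite expn_gt0.
by nia.
Qed.

Lemma letter_leq c i : letter c i <= c.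
Proof.
rewrite /letter; case: (ltnP i (size (CodeSeq.decode c))) => [lti|ge]; last first.
  by rewrite nth_default.
by apply: ltnW; apply: (allP (CodeSeq.gtn_decode c)); exact: mem_nth.
Qed.

Lemma recn_code_pair k f g : recn k f -> recn k g ->
  recn k (fun v => CodeSeq.code [:: f v; g v]).
Proof.
move=> Hf Hg; have : recn k (fun v => 2 ^ f v * (2 ^ g v * 0.*2.+1).*2.+1) by rec.
exact.
Qed.

Lemma recn_decode_head k f : recn k f -> recn k (fun v => head 0 (CodeSeq.decode (f v))).
Proof.
move=> Hf; have : recn k (fun v =>
  find (fun a => has (fun t => f v == 2 ^ a * t.*2.+1) (iota 0 (f v))) (iota 0 (f v))).
  by rec.
move/recn_ext; apply=> v; move: (f v) => c.
case E: (CodeSeq.decode c) => [|a s] /=.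
  by move/eqP: E; rewrite decode_nil => /eqP->.
have [Ec ltac lts] := decodeP E.
apply: find_iota => [|_|y lty]; first exact: ltnW.
  by apply/hasP; exists (CodeSeq.code s); rewrite ?mem_iota //= -Ec.
apply/hasPn => t _; apply/eqP => Ect; move: E lty; rewrite Ect decode_cons.
by case=> -> _; rewrite ltnn.
Qed.

Lemma recn_decode_behead k f : recn k f ->
  recn k (fun v => CodeSeq.code (behead (CodeSeq.decode (f v)))).
Proof.
move=> Hf; have : recn k (fun v =>
  find (fun t => has (fun a => f v == 2 ^ a * t.*2.+1) (iota 0 (f v))) (iota 0 (f v))).
  by rec.
move/recn_ext; apply=> v; move: (f v) => c.
case E: (CodeSeq.decode c) => [|a s].
  by move/eqP: E; rewrite decode_nil => /eqP->.
rewrite [behead _]/=; have [Ec ltac lts] := decodeP E.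
apply: find_iota => [|_|y lty]; first exact: ltnW.
  by apply/hasP; exists a; rewrite ?mem_iota //= -Ec.
apply/hasPn => b _; apply/eqP => Ect; move: E lty; rewrite Ect decode_cons.
by case=> _ <-; rewrite CodeSeq.decodeK ltnn.
Qed.

#[local] Hint Resolve recn_code_pair recn_decode_head recn_decode_behead : rec.

Lemma recn_decode_drop k n f : recn k n -> recn k f ->
  recn k (fun v => CodeSeq.code (drop (n v) (CodeSeq.decode (f v)))).
Proof.
move=> Hn Hf.
have := @recn_iter k n f (fun x _ => CodeSeq.code (behead (CodeSeq.decode x)))
          Hn Hf ltac:(rec).
move/recn_ext; apply=> v; elim: (n v) => [|m /= ->].
  by rewrite drop0 CodeSeq.decodeK.
by rewrite CodeSeq.codeK -drop1 drop_drop add1n.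
Qed.

#[local] Hint Resolve recn_decode_drop : rec.

Lemma recn_letter k f n : recn k f -> recn k n -> recn k (fun v => letter (f v) (n v)).
Proof.
move=> Hf Hn.
have : recn k (fun v => head 0 (CodeSeq.decode
  (CodeSeq.code (drop (n v) (CodeSeq.decode (f v)))))) by rec.
by move/recn_ext; apply=> v; rewrite CodeSeq.codeK -nth0 nth_drop addn0.
Qed.

Lemma recn_size k f : recn k f -> recn k (fun v => size (CodeSeq.decode (f v))).
Proof.
move=> Hf; have : recn k (fun v =>
  find (fun i => CodeSeq.code (drop i (CodeSeq.decode (f v))) == 0) (iota 0 (f v))).
  by rec.
move/recn_ext; apply=> v; move: (f v) => c.
apply: find_iota => [|_|y lty]; first exact: size_decode.
  by rewrite drop_size.
by rewrite -decode_nil CodeSeq.codeK -size_eq0 size_drop subn_eq0 -ltnNge.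
Qed.

#[local] Hint Resolve recn_letter recn_size : rec.

(** A list of words is encoded by the list of the codes of its words. *)
Definition wordlist (c : nat) : seq (seq nat) :=
  [seq CodeSeq.decode d | d <- CodeSeq.decode c].

Lemma size_wordlist c w : w \in wordlist c -> size w <= c.
Proof.
move=> /mapP[d /(allP (CodeSeq.gtn_decode c)) /= ltdc ->].
by apply: leq_trans (size_decode d) (ltnW ltdc).
Qed.

Lemma recb_all_wordlist k f (p : seq nat -> seq nat -> bool) : recn k f ->
  recb k.+1 (fun v => p (CodeSeq.decode (head 0 v)) (behead v)) ->
  recb k (fun v => all (fun w => p w v) (wordlist (f v))).
Proof.
move=> Hf Hp.
have Hp' : recb k.+1 (fun v => p (CodeSeq.decode (letter (f (behead v)) (head 0 v))) (behead v)).
  apply: (@recn_subst k.+1 k.+1 (fun v => nat_of_bool (p (CodeSeq.decode (head 0 v)) (behead v)))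
    (fun v => letter (f (behead v)) (head 0 v) :: behead v)) => // [v|[|i] lti].
  - by rewrite /= size_behead => ->.
  - by rewrite /=; rec.
  - apply: (@recn_ext _ (fun v => nth 0 v i.+1)); first exact: recn_nth.
    by move=> v; rewrite /= nth_behead.
have := @recb_all k _ (fun i v => p (CodeSeq.decode (letter (f v) i)) v) (recn_size Hf) Hp'.
move/recb_ext; apply=> v; rewrite /wordlist all_map.
rewrite -{2}(mkseq_nth 0 (CodeSeq.decode (f v))) /mkseq all_map.
by apply: eq_all.
Qed.
#[local] Hint Resolve recb_all_wordlist : rec.

(** Every word of length [L] over the alphabet [{0, ..., s - 1}] has a code at
    most [wbound s L]. *)
Definition wbound (s L : nat) := iter L (fun B => 2 ^ s * B.*2.+1) 0.

Lemma recn_wbound k s L : recn k s -> recn k L -> recn k (fun v => wbound (s v) (L v)).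
Proof.
move=> Hs HL.
exact: (@recn_iter k L _ (fun B v => 2 ^ s v * B.*2.+1) HL (recn_const k 0) ltac:(rec)).
Qed.
#[local] Hint Resolve recn_wbound : rec.

Lemma word_code s L (g : nat -> nat) : (forall j, j < L -> g j < s) ->
  exists2 c, c \in iota 0 (wbound s L).+1 & forall j, j < L -> letter c j = g j.
Proof.
move=> Hg; exists (CodeSeq.code (mkseq g L)); last first.
  by move=> j ltj; rewrite /letter CodeSeq.codeK nth_mkseq.
rewrite mem_iota ltnS /=.
elim: L g Hg => // L IH g Hg; rewrite /mkseq /= (iotaDl 1 0) -map_comp.
apply: leq_mul; first by rewrite leq_exp2l // ltnW // Hg.
by rewrite ltnS leq_double; apply: (IH (g \o S)) => j ltj; exact: Hg.
Qed.

(** * Words *)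

(** A word is a function [g : nat -> nat] together with a length [L]; the values
    [g j] for [L <= j] are irrelevant. *)

(** The sequence [w] occurs in [g] at the position [p]. *)
Definition occurs (w : seq nat) (g : nat -> nat) (p : nat) : bool :=
  all (fun l => g (p + l) == nth 0 w l) (iota 0 (size w)).

(** No sequence of [F] occurs in the word [g] of length [L]. *)
Definition avoids (F : seq (seq nat)) (L : nat) (g : nat -> nat) : bool :=
  all (fun w => all (fun p => (p + size w <= L) ==> ~~ occurs w g p) (iota 0 L.+1)) F.

(** The word [g] is over the alphabet [{0, ..., s - 1}]. *)
Definition bounded (s L : nat) (g : nat -> nat) : bool :=
  all (fun j => g j < s) (iota 0 L).

Definition admissible s F L g : bool := bounded s L g && avoids F L g.

(** The letter that encodes a pair of letters. *)
Definition pair_code (a b : nat) : nat := CodeSeq.code [:: a; b].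

Lemma occursP w g p :
  reflect (forall l, l < size w -> g (p + l) = nth 0 w l) (occurs w g p).
Proof.
apply: (iffP allP) => H l => [lt|]; first by apply/eqP/H; rewrite mem_iota.
by rewrite mem_iota => /H ->.
Qed.

Lemma avoidsP F L g :
  reflect (forall w p, w \in F -> p + size w <= L -> ~~ occurs w g p) (avoids F L g).
Proof.
apply: (iffP allP) => [H w p wF le|H w wF].
  have /allP/(_ p) := H w wF; rewrite mem_iota le; apply; lia.
by apply/allP => p _; apply/implyP; exact: H.
Qed.

Lemma boundedP s L g : reflect (forall j, j < L -> g j < s) (bounded s L g).
Proof.
apply: (iffP allP) => H j => [lt|]; first by apply: H; rewrite mem_iota.
by rewrite mem_iota; exact: H.
Qed.

Lemma eq_occurs w g p g' p' : (forall l, l < size w -> g (p + l) = g' (p' + l)) ->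
  occurs w g p = occurs w g' p'.
Proof.
by move=> E; apply: eq_in_all => l; rewrite mem_iota => /E ->.
Qed.

Lemma avoids_sub F L g L' g' p : avoids F L g -> p + L' <= L ->
  (forall j, j < L' -> g' j = g (p + j)) -> avoids F L' g'.
Proof.
move=> /avoidsP H le E; apply/avoidsP => w q wF leq.
rewrite (@eq_occurs w g' q g (p + q)) => [|l ltl]; last by rewrite E ?addnA //; lia.
by apply: H => //; lia.
Qed.

Lemma admissible_sub s F L g L' g' p : admissible s F L g -> p + L' <= L ->
  (forall j, j < L' -> g' j = g (p + j)) -> admissible s F L' g'.
Proof.
move=> /andP[/boundedP b a] le E; rewrite /admissible (avoids_sub a le E) andbT.
by apply/boundedP => j ltj; rewrite E //; apply: b; lia.
Qed.

Lemma eq_avoids F L g g' : (forall j, j < L -> g j = g' j) ->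
  avoids F L g = avoids F L g'.
Proof.
move=> E; apply/idP/idP => H.
  by apply: (@avoids_sub _ _ _ _ _ 0 H) => // j /E.
by apply: (@avoids_sub _ _ _ _ _ 0 H) => // j /E.
Qed.

Lemma eq_admissible s F L g g' : (forall j, j < L -> g j = g' j) ->
  admissible s F L g = admissible s F L g'.
Proof.
move=> E; rewrite /admissible (eq_avoids _ E); congr (_ && _).
by apply: eq_in_all => j; rewrite mem_iota => /E ->.
Qed.

(** Two words that overlap on [k] letters can be glued when no forbidden word
    is longer than [k]: [g] has length [n + q], its prefix of length [n] avoids
    [F], and its last [k + q] letters are those of a word that avoids [F]. *)
Lemma avoids_glue F k n n' q g g' : (forall w : seq nat, w \in F -> size w <= k) ->
  k <= n -> k <= n' -> avoids F n g -> avoids F (n' + q) g' ->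
  (forall j, j < k + q -> g (n - k + j) = g' (n' - k + j)) -> avoids F (n + q) g.
Proof.
move=> Fk kn kn' /avoidsP H /avoidsP H' E; apply/avoidsP => w p wF le.
case: (leqP (p + size w) n) => [|lt]; first exact: H.
have sw := Fk _ wF.
rewrite (@eq_occurs w g p g' (n' - k + (p - (n - k)))) => [|l ltl].
  by apply: H' => //; lia.
rewrite -addnA -E; last by lia.
by congr g; lia.
Qed.

Lemma admissible_glue s F k n n' q g g' : (forall w : seq nat, w \in F -> size w <= k) ->
  k <= n -> k <= n' -> admissible s F n g -> admissible s F (n' + q) g' ->
  (forall j, j < k + q -> g (n - k + j) = g' (n' - k + j)) ->
  admissible s F (n + q) g.
Proof.
move=> Fk kn kn' /andP[/boundedP b a] /andP[/boundedP b' a'] E.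
rewrite /admissible (avoids_glue Fk kn kn' a a' E) andbT; apply/boundedP => j ltj.
case: (ltnP j n) => [/b //|le]; rewrite (_ : j = n - k + (j - (n - k))); last by lia.
by rewrite E; [apply: b' | ]; lia.
Qed.

(** ** The certificate *)

(** Two presentations are given by the sizes [s1], [s2] of their alphabets, their
    forbidden words [F1], [F2] and their forbidden pairs [G1], [G2]; the forbidden
    words [H] over the letters [pp a b] describe a relation between their
    configurations. The number [k] bounds the lengths of all forbidden words. The
    parameter [b] is 0 over the natural numbers and 1 over the integers: words are
    extended by [m] letters to the right and by [b * m] letters to the left. *)
Section Certificate.
Variables (b : nat) (pp : nat -> nat -> nat).
Variables (s1 : nat) (F1 G1 : seq (seq nat)) (s2 : nat) (F2 G2 : seq (seq nat)).
Variables (H : seq (seq nat)) (k : nat).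

(** [(u, v)] is a word of length [L] of the relation. *)
Definition related L (u v : nat -> nat) : bool :=
  [&& admissible s1 F1 L u, admissible s2 F2 L v & avoids H L (fun j => pp (u j) (v j))].

(** In pairs of words of the relation, no forbidden pair of the second
    presentation is seen at the middle position [b * m] when the first components
    show none of the first presentation. The words of [G2] should have length at
    most [m]. *)
Definition compatible m := forall u v u' v',
  let L := b * m + m in
  related L u v -> related L u' v' -> avoids G1 L (fun j => pair_code (u j) (u' j)) ->
  forall w, w \in G2 -> ~~ occurs w (fun j => pair_code (v j) (v' j)) (b * m).

(** The word [e'] of length [n'] has the same last [k] letters as the
    word [e] of length [n], and the last [k] letters of every lift of [e'] are the
    last [k] letters of a lift of [e]. *)
Definition simulates n' (e' : nat -> nat) n (e : nat -> nat) :=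
  (forall j, j < k -> e' (n' - k + j) = e (n - k + j)) /\
  forall v', related n' e' v' ->
  exists2 v, related n e v & forall j, j < k -> v (n - k + j) = v' (n' - k + j).

(** The relation is total: every word of length between [k] and [N] with an
    extension by [m] has a lift, and every such word of length [N + 1] is
    simulated by a shorter one. *)
Definition total m N := let mid (e : nat -> nat) j := e (b * m + j) in
  (forall n e, k <= n <= N -> admissible s1 F1 (b * m + n + m) e ->
     exists v, related n (mid e) v) /\
  (forall e, admissible s1 F1 (b * m + N.+1 + m) e ->
     exists n e', [/\ k <= n <= N, admissible s1 F1 (b * m + n + m) e' &
       simulates n (mid e') N.+1 (mid e)]).

End Certificate.

(** ** The certificate is decidable *)

(** In the Boolean versions, words range over codes below an explicit bound. *)
Section Decision.
Variables (b : nat) (pp : nat -> nat -> nat).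
Variables (s1 : nat) (F1 G1 : seq (seq nat)) (s2 : nat) (F2 G2 : seq (seq nat)).
Variables (H : seq (seq nat)) (k : nat).

Local Notation related := (related pp s1 F1 s2 F2 H).

Lemma admissible_code s F L g : admissible s F L g ->
  exists2 c, c \in iota 0 (wbound s L).+1 & forall j, j < L -> letter c j = g j.
Proof. by move=> /andP[/boundedP /word_code]. Qed.

Lemma eq_related L u v u' v' :
  (forall j, j < L -> u j = u' j) -> (forall j, j < L -> v j = v' j) ->
  related L u v = related L u' v'.
Proof.
move=> Eu Ev; rewrite /related (eq_admissible _ _ Eu) (eq_admissible _ _ Ev).
by congr [&& _, _ & _]; apply: eq_avoids => j ltj; rewrite Eu ?Ev.
Qed.

Lemma related_code L u v : related L u v -> exists c d,
  [/\ c \in iota 0 (wbound s1 L).+1, d \in iota 0 (wbound s2 L).+1,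
      forall j, j < L -> letter c j = u j & forall j, j < L -> letter d j = v j].
Proof.
by move=> /and3P[/admissible_code[c ? ?] /admissible_code[d ? ?] _]; exists c, d.
Qed.

Definition compatibleb m := let L := b * m + m in
  all (fun u => all (fun v => all (fun u' => all (fun v' =>
    [&& related L (letter u) (letter v), related L (letter u') (letter v') &
        avoids G1 L (fun j => pair_code (letter u j) (letter u' j))] ==>
    all (fun w => ~~ occurs w (fun j => pair_code (letter v j) (letter v' j)) (b * m)) G2)
  (iota 0 (wbound s2 L).+1)) (iota 0 (wbound s1 L).+1))
  (iota 0 (wbound s2 L).+1)) (iota 0 (wbound s1 L).+1).

Lemma compatibleP m : (forall w : seq nat, w \in G2 -> size w <= m) ->
  reflect (compatible b pp s1 F1 G1 s2 F2 G2 H m) (compatibleb m).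
Proof.
move=> G2m; apply: (iffP idP) => [C u v u' v' L R R' A w wG2|C].
  have [c [d [cr dr cu dv]]] := related_code R.
  have [c' [d' [cr' dr' cu' dv']]] := related_code R'.
  have := allP (allP (allP (allP C _ cr) _ dr) _ cr') _ dr'.
  rewrite (eq_related cu dv) (eq_related cu' dv') R R'.
  rewrite -(@eq_avoids _ _ (fun j => pair_code (u j) (u' j))) => [|j ltj]; last first.
    by rewrite cu ?cu'.
  rewrite A /= => /allP/(_ _ wG2); congr (~~ _); apply: eq_occurs => l ltl.
  have ltL : b * m + l < L by have := G2m _ wG2; rewrite /L; lia.
  by rewrite dv ?dv'.
apply/allP => u _; apply/allP => v _; apply/allP => u' _; apply/allP => v' _.
apply/implyP => /and3P[R R' A]; apply/allP => w wG2.
exact: C R R' A w wG2.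
Qed.

Definition simulatesb o n' e' n e :=
  all (fun j => letter e' (o + (n' - k + j)) == letter e (o + (n - k + j))) (iota 0 k) &&
  all (fun v' => related n' (fun j => letter e' (o + j)) (letter v') ==>
    has (fun v => related n (fun j => letter e (o + j)) (letter v) &&
      all (fun j => letter v (n - k + j) == letter v' (n' - k + j)) (iota 0 k))
    (iota 0 (wbound s2 n).+1)) (iota 0 (wbound s2 n').+1).

Lemma all_eqP (f g : nat -> nat) :
  reflect (forall j, j < k -> f j = g j) (all (fun j => f j == g j) (iota 0 k)).
Proof.
apply: (iffP allP) => E j => [lt|]; first by apply/eqP/E; rewrite mem_iota.
by rewrite mem_iota => /E ->.
Qed.

Lemma simulatesP o n' e' n e f' f : k <= n' -> k <= n ->
  (forall j, j < n' -> letter e' (o + j) = f' j) ->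
  (forall j, j < n -> letter e (o + j) = f j) ->
  reflect (simulates pp s1 F1 s2 F2 H k n' f' n f) (simulatesb o n' e' n e).
Proof.
move=> kn' kn Ee' Ee; apply: (iffP andP) => [[/all_eqP E S]|[E S]].
  split=> [j ltj|v' R]; first by rewrite -Ee' ?E ?Ee //; lia.
  have [_ [d' [_ dr' _ dv']]] := related_code R.
  have /implyP := allP S _ dr'.
  rewrite (eq_related Ee' dv') => /(_ R) /hasP[d _ /andP[Rd /all_eqP Ed]].
  exists (letter d) => [|j ltj]; first by rewrite -(eq_related Ee (fun _ _ => erefl)).
  by rewrite Ed // dv' //; lia.
split; first by apply/all_eqP => j ltj; rewrite Ee' ?E ?Ee //; lia.
apply/allP => v' _; apply/implyP; rewrite (eq_related Ee' (fun _ _ => erefl)).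
move=> /S[v R Ev]; have [_ [d [_ dr _ dv]]] := related_code R.
apply/hasP; exists d => //; rewrite (eq_related Ee dv) R /=.
by apply/all_eqP => j ltj; rewrite -Ev // dv //; lia.
Qed.

Definition totalb m N := let o := b * m in
  all (fun n => (k <= n) ==>
    all (fun e => admissible s1 F1 (o + n + m) (letter e) ==>
      has (fun v => related n (fun j => letter e (o + j)) (letter v))
      (iota 0 (wbound s2 n).+1)) (iota 0 (wbound s1 (o + n + m)).+1)) (iota 0 N.+1) &&
  all (fun e => admissible s1 F1 (o + N.+1 + m) (letter e) ==>
    has (fun n => (k <= n) &&
      has (fun e' => admissible s1 F1 (o + n + m) (letter e') && simulatesb o n e' N.+1 e)
      (iota 0 (wbound s1 (o + n + m)).+1)) (iota 0 N.+1))
  (iota 0 (wbound s1 (o + N.+1 + m)).+1).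

Lemma totalP m N : k <= N ->
  reflect (total b pp s1 F1 s2 F2 H k m N) (totalb m N).
Proof.
move=> kN; apply: (iffP andP) => [[T1 T2]|[T1 T2]]; split.
- move=> n e /andP[kn nN] A; have [c cr ce] := admissible_code A.
  have ltn : n \in iota 0 N.+1 by rewrite mem_iota ltnS.
  have /implyP/(_ kn)/allP/(_ c cr)/implyP := allP T1 n ltn.
  rewrite (eq_admissible _ _ ce) => /(_ A)/hasP[v _ R]; exists (letter v).
  rewrite -(@eq_related n (fun j => letter c (b * m + j)) (letter v)) // => j ltj.
  by rewrite ce //; lia.
- move=> e A; have [c cr ce] := admissible_code A.
  have /implyP := allP T2 c cr; rewrite (eq_admissible _ _ ce) => /(_ A)/hasP[n].
  rewrite mem_iota ltnS => nN /andP[kn /hasP[e' _ /andP[A' S]]].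
  exists n, (letter e'); split=> //; first by rewrite kn.
  by apply/(simulatesP _ _ _ _ S) => // [|j ltj]; [lia | rewrite ce //; lia].
- apply/allP => n; rewrite mem_iota ltnS => nN; apply/implyP => kn.
  apply/allP => e _; apply/implyP => A.
  have [|v R] := T1 n (letter e) _ A; first by rewrite kn.
  have [_ [d [_ dr _ dv]]] := related_code R.
  by apply/hasP; exists d => //; rewrite (eq_related (fun _ _ => erefl) dv).
- apply/allP => e _; apply/implyP => A; have [n [e' [/andP[kn nN] A' S]]] := T2 _ A.
  apply/hasP; exists n; rewrite ?mem_iota //; apply/andP; split=> //.
  have [c cr ce] := admissible_code A'; apply/hasP; exists c => //.
  rewrite (eq_admissible _ _ ce) A' /=.
  by apply: (introT (simulatesP _ _ _ _) S) => // [|j ltj]; [lia | rewrite ce //; lia].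
Qed.

End Decision.

(** Applies a computable function with one distinguished argument below [d]
    further binders. *)
Lemma recn_app d n k g f : n = d + k -> recn k.+1 (fun v => g (head 0 v) (behead v)) ->
  recn n f -> recn n (fun v => g (f v) (iter d behead v)).
Proof.
move=> -> Hg Hf; have sz v : size v = d + k -> size (iter d behead v) = k.
  by elim: d {f Hf} v => [|d IH] v sv //; rewrite iterSr IH // size_behead sv.
apply: (@recn_subst (d + k) k.+1 (fun v => g (head 0 v) (behead v))
  (fun v => f v :: iter d behead v)) => // [v /sz /= -> //|[|i] lti] //=.
apply: (@recn_ext _ (fun v => nth 0 v (d + i))); first by apply: recn_nth; lia.
move=> v; elim: d v {f Hf sz} => // d IH v.
by rewrite iterSr -IH nth_behead addSn.
Qed.

Lemma recb_occurs k w g p : recn k w -> recn k p ->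
  recn k.+1 (fun v => g (head 0 v) (behead v)) ->
  recb k (fun v => occurs (CodeSeq.decode (w v)) (g^~ v) (p v)).
Proof.
move=> Hw Hp Hg; apply: (@recb_all _ _ (fun l v =>
  g (p v + l) v == letter (w v) l)); first by rec.
apply: recb_eq; last by rec.
by apply: (@recn_app 1 k.+1 k g) => //; rec.
Qed.
#[local] Hint Resolve recb_occurs : rec.

Lemma recb_avoids k F L g : recn k F -> recn k L ->
  recn k.+1 (fun v => g (head 0 v) (behead v)) ->
  recb k (fun v => avoids (wordlist (F v)) (L v) (g^~ v)).
Proof.
move=> HF HL Hg.
apply: (@recb_all_wordlist k F (fun w v => all (fun p => (p + size w <= L v) ==>
  ~~ occurs w (g^~ v) p) (iota 0 (L v).+1))) => //.
apply: (@recb_all k.+1 (fun v => (L (behead v)).+1) (fun p v =>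
  (p + size (CodeSeq.decode (head 0 v)) <= L (behead v)) ==>
  ~~ occurs (CodeSeq.decode (head 0 v)) (g^~ (behead v)) p)); first by rec.
apply: recb_imply; first by rec.
apply: recb_not; apply: (@recb_occurs k.+2 _ (fun x v => g x (behead (behead v)))); try by rec.
by apply: (@recn_app 3 k.+3 k g) => //; rec.
Qed.
#[local] Hint Resolve recb_avoids : rec.

Lemma recb_admissible k s F L g : recn k s -> recn k F -> recn k L ->
  recn k.+1 (fun v => g (head 0 v) (behead v)) ->
  recb k (fun v => admissible (s v) (wordlist (F v)) (L v) (g^~ v)).
Proof.
move=> Hs HF HL Hg; apply: recb_and; last by rec.
by apply: (@recb_all k L (fun j v => g j v < s v)); rec.
Qed.
#[local] Hint Resolve recb_admissible : rec.

Lemma recn_pair_code k f g : recn k f -> recn k g ->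
  recn k (fun v => pair_code (f v) (g v)).
Proof. exact: recn_code_pair. Qed.
#[local] Hint Resolve recn_pair_code : rec.

Section Computation.
Variables (b : nat) (pp : nat -> nat -> nat).
Hypothesis recn_pp : forall k f g, recn k f -> recn k g -> recn k (fun v => pp (f v) (g v)).
#[local] Hint Resolve recn_pp : rec.
(* The alphabet and the forbidden words of the presentation with code [c]. *)
Local Notation s c := (letter c 0).
Local Notation F c := (wordlist (letter c 1)).
Local Notation G c := (wordlist (letter c 2)).

Lemma recb_related k c1 c2 h L u v : recn k c1 -> recn k c2 -> recn k h -> recn k L ->
  recn k.+1 (fun x => u (head 0 x) (behead x)) ->
  recn k.+1 (fun x => v (head 0 x) (behead x)) ->
  recb k (fun x => related pp (s (c1 x)) (F (c1 x)) (s (c2 x)) (F (c2 x))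
    (wordlist (h x)) (L x) (u^~ x) (v^~ x)).
Proof. by move=> *; do 2![apply: recb_and; first by rec]; rec. Qed.
#[local] Hint Resolve recb_related : rec.

Lemma recb_compatible k c1 c2 h m : recn k c1 -> recn k c2 -> recn k h -> recn k m ->
  recb k (fun x => compatibleb b pp (s (c1 x)) (F (c1 x)) (G (c1 x))
    (s (c2 x)) (F (c2 x)) (G (c2 x)) (wordlist (h x)) (m x)).
Proof. by move=> *; rewrite /compatibleb; rec. Qed.


Lemma recb_simulates k c1 c2 h l o n' e' n e :
  recn k c1 -> recn k c2 -> recn k h -> recn k l -> recn k o ->
  recn k n' -> recn k e' -> recn k n -> recn k e ->
  recb k (fun x => simulatesb pp (s (c1 x)) (F (c1 x)) (s (c2 x)) (F (c2 x))
    (wordlist (h x)) (l x) (o x) (n' x) (e' x) (n x) (e x)).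
Proof. by move=> *; rewrite /simulatesb; rec. Qed.
#[local] Hint Resolve recb_simulates : rec.

Lemma recb_total k c1 c2 h l m N :
  recn k c1 -> recn k c2 -> recn k h -> recn k l -> recn k m -> recn k N ->
  recb k (fun x => totalb b pp (s (c1 x)) (F (c1 x)) (s (c2 x)) (F (c2 x))
    (wordlist (h x)) (l x) (m x) (N x)).
Proof. by move=> *; rewrite /totalb; rec. Qed.

End Computation.
#[local] Hint Extern 1 (recb _ (fun x => compatibleb _ _ _ _ _ _ _ _ _ _)) =>
  apply recb_compatible; [move=> *; rec | | | |] : rec.
#[local] Hint Extern 1 (recb _ (fun x => totalb _ _ _ _ _ _ _ _ _ _)) =>
  apply recb_total; [move=> *; rec | | | | | |] : rec.

(** The conditions that make the relation with forbidden words [h] induce a map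
    from the system with code [c1] to the system with code [c2]; [pp] tells how
    the letters of the words of [h] encode pairs. *)
Definition half_check b pp c1 c2 h k m m' N : bool :=
  compatibleb b pp (letter c1 0) (wordlist (letter c1 1)) (wordlist (letter c1 2))
    (letter c2 0) (wordlist (letter c2 1)) (wordlist (letter c2 2)) (wordlist h) m &&
  totalb b pp (letter c1 0) (wordlist (letter c1 1))
    (letter c2 0) (wordlist (letter c2 1)) (wordlist h) k m' N.

(** The number [t] encodes the forbidden words of a relation, the parameters of
    its certificate and those of the certificate of the inverse relation. The sum
    [k] of the codes bounds the lengths of all forbidden words. *)
Definition check b c1 c2 t : bool :=
  let h := letter t 0 in let k := c1 + c2 + h in
  half_check b pair_code c1 c2 h k (k + letter t 1) (letter t 2) (k + letter t 3) &&
  half_check b (fun x y => pair_code y x) c2 c1 h k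
    (k + letter t 4) (letter t 5) (k + letter t 6).

Lemma recb_check b :
  recb 3 (fun v => check b (nth 0 v 1) (nth 0 v 2) (nth 0 v 0)).
Proof. by rewrite /check /half_check; rec. Qed.

Lemma check_semidecidable b : exists e, forall c1 c2,
  halts e [:: c1; c2] <-> exists t, check b c1 c2 t.
Proof.
have [e He] := recb_not (recb_check b); exists (RMin e) => c1 c2; split.
  case=> t /[dup] H _; inversion H as [| | | | | |f v n k _ Ht]; subst; exists t.
  by have /= := computes_fun Ht (He [:: t; c1; c2] erefl); case: check.
case=> t0 Ht0; have [t Ht tmin] := ex_minnP (ex_intro (check b c1 c2) t0 Ht0).
exists t; apply: (@computes_min _ _ _ (fun=> 0)) => [m ltm|].
  have := He [:: m; c1; c2] erefl; rewrite /=; case: (boolP (check b c1 c2 m)) => //.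
  by move=> /tmin; rewrite leqNgt ltm.
by have := He [:: t; c1; c2] erefl; rewrite /= Ht.
Qed.

(** * Limits of words *)

Section Ultralimits.
Variables (U : set_system nat) (UU : UltraFilter U).

Lemma ultra_forall (P : nat -> nat -> Prop) L :
  (forall l, l < L -> U (P l)) -> U (fun n => forall l, l < L -> P l n).
Proof.
elim: L => [|L IH] H; first by apply: filterS filterT.
have H1 : U (fun n => forall l, l < L -> P l n) by apply: IH => l ltl; apply: H; lia.
apply: filterS2 H1 (H L (ltnSn L)) => n H1 H2 l.
by rewrite ltnS leq_eqVlt => /orP[/eqP->|/H1].
Qed.

(** A sequence with finitely many values is constant along an ultrafilter. *)
Lemma ultra_const (f : nat -> nat) s : U (fun n => f n < s) ->
  exists2 a, a < s & U (fun n => f n = a).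
Proof.
elim: s => [|s IH] H.
  by have [n] := @filter_ex _ U _ _ H.
case: (in_ultra_setVsetC (fun n => f n = s) UU) => H'; first by exists s.
have [|a lta Ha] := IH; last by exists a => //; lia.
apply: filterS2 H H' => n lt ne; rewrite ltn_neqAle -ltnS lt andbT.
by apply/eqP.
Qed.

(** Compactness: pointwise limits of configurations over a finite alphabet. *)
Lemma ultra_config (M : Type) (y : nat -> M -> nat) s :
  (forall i, U (fun n => y n i < s)) ->
  exists2 x : M -> nat, forall i, x i < s & forall i, U (fun n => y n i = x i).
Proof.
move=> H; have /choice[x Hx] i : exists a, a < s /\ U (fun n => y n i = a).
  by have [a lta Ha] := ultra_const (H i); exists a.
by exists x => i; have [] := Hx i.
Qed.

End Ultralimits.

Lemma free_ultrafilter : exists U : set_system nat,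
  UltraFilter U /\ forall N, U (fun n => N <= n).
Proof.
have [U [UU sub]] := @ultraFilterLemma _ (\oo)%classic _.
exists U; split=> // N; apply: sub; exists N => //.
Qed.

(** * Configurations *)

Local Open Scope ring_scope.
Import GRing.Theory.

(** A uniform view of the natural numbers ([win_left] = 0) and of the integers
    ([win_left] = 1): the [n]-th window has [win_left * n + n] positions, starts
    at [win_org n], and has the position 0 at index [win_left * n]. The windows
    exhaust the monoid. *)
Record windows (M : pzSemiRingType) := Windows {
  win_left : nat;
  win_org : nat -> M;
  win_idx : nat -> M -> nat;
  win_orgK : forall n, win_org n + (win_left * n)%:R = 0;
  win_idxK : forall n j, win_idx n (win_org n + j%:R) = j;
  win_cover : forall i L, exists N, forall n, (N <= n)%N ->
    exists2 j, i = win_org n + j%:R & (j + L <= win_left * n + n)%N }.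

Section Configurations.
Variables (M : pzSemiRingType) (ws : windows M).
Local Notation b := (win_left ws).
Local Notation org := (win_org ws).
Local Notation idx := (win_idx ws).
Implicit Types (x y : M -> nat) (i : M) (F G H : seq (seq nat)).

(** The infinite word read in [x] from position [i]. *)
Definition read x i : nat -> nat := fun l => x (i + l%:R).

Definition avoids_config F x := forall w i, w \in F -> ~~ occurs w (read x i) 0.

(** [x] is a point of the subshift over [{0, ..., s - 1}] defined by [F]. *)
Definition in_shift (s : nat) F x := (forall i, x i < s)%N /\ avoids_config F x.

Lemma occurs_read w x i p : occurs w (read x i) p = occurs w (read x (i + p%:R)) 0.
Proof.
by apply: eq_occurs => l _; rewrite /read natrD addrA.
Qed.

Lemma avoids_read F x i L : avoids_config F x -> avoids F L (read x i).
Proof. by move=> Fx; apply/avoidsP => w p wF _; rewrite occurs_read; exact: Fx. Qed.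

Lemma admissible_read s F x i L : in_shift s F x -> admissible s F L (read x i).
Proof.
move=> [b_x /(avoids_read i L) a_x]; rewrite /admissible a_x andbT.
by apply/boundedP => j _; exact: b_x.
Qed.

Section Limit.
Variables (U : set_system nat) (UU : UltraFilter U).
Hypothesis Uoo : forall N, U (fun n => (N <= n)%N).

(** The configuration [x] is the limit of the words [g n], each placed in the
    window of the same index. *)
Definition word_limit (g : nat -> nat -> nat) x :=
  forall i, U (fun n => g n (idx n i) = x i).

Lemma word_limit_exists g s : U (fun n => bounded s (b * n + n) (g n)) ->
  exists2 x, (forall i, x i < s)%N & word_limit g x.
Proof.
move=> Ug; apply: (@ultra_config U UU M (fun n i => g n (idx n i))) => i.
have [N HN] := win_cover ws i 1.
apply: filterS2 Ug (Uoo N) => n /boundedP gb /HN[j -> lt]; rewrite win_idxK.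
by apply: gb; lia.
Qed.

Lemma word_limit_read g x i L : word_limit g x ->
  U (fun n => exists2 j, (j + L <= b * n + n)%N &
      i = org n + j%:R /\ forall l, (l < L)%N -> g n (j + l)%N = read x i l).
Proof.
move=> gx; have [N HN] := win_cover ws i L.
have H := ultra_forall UU (fun l (_ : (l < L)%N) => gx (i + l%:R)).
apply: filterS2 H (Uoo N) => n H /HN[j Ei le].
exists j => //; split=> // l ltl.
by rewrite /read -(H l ltl) Ei -addrA -natrD win_idxK.
Qed.

Lemma word_limit_avoids F g x : word_limit g x ->
  U (fun n => avoids F (b * n + n) (g n)) -> avoids_config F x.
Proof.
move=> gx Fg w i wF.
have [n [/avoidsP Fgn [j le [_ E]]]] :=
  filter_ex (filterI Fg (word_limit_read i (size w) gx)).
rewrite (@eq_occurs _ _ _ (g n) j) => [|l ltl]; first exact: Fgn.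
by rewrite E.
Qed.

Lemma word_limit_in_shift s F g : U (fun n => admissible s F (b * n + n) (g n)) ->
  exists2 x, in_shift s F x & word_limit g x.
Proof.
move=> Ug; have [|x bx gx] := @word_limit_exists g s.
  by apply: filterS Ug => n /andP[].
exists x => //; split=> //; apply: word_limit_avoids gx _.
by apply: filterS Ug => n /andP[].
Qed.

Lemma word_limit_pair g h x y (f : nat -> nat -> nat) :
  word_limit g x -> word_limit h y ->
  word_limit (fun n j => f (g n j) (h n j)) (fun i => f (x i) (y i)).
Proof. by move=> gx hy i; apply: filterS2 (gx i) (hy i) => n -> ->. Qed.

End Limit.

End Configurations.

(** * Soundness and completeness of the certificate *)

Section Relation.
Variables (M : pzSemiRingType) (ws : windows M) (pp : nat -> nat -> nat).
Variables (s1 : nat) (F1 G1 : seq (seq nat)) (s2 : nat) (F2 G2 : seq (seq nat)).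
Variables (H : seq (seq nat)) (k : nat).
Hypothesis F1k : forall w : seq nat, w \in F1 -> (size w <= k)%N.
Hypothesis F2k : forall w : seq nat, w \in F2 -> (size w <= k)%N.
Hypothesis Hk : forall w : seq nat, w \in H -> (size w <= k)%N.
Local Notation b := (win_left ws).
Local Notation org := (win_org ws).
Local Notation idx := (win_idx ws).
Local Notation related := (related pp s1 F1 s2 F2 H).
Local Notation simulates := (simulates pp s1 F1 s2 F2 H k).
Local Notation compatible := (compatible b pp s1 F1 G1 s2 F2 G2 H).
Local Notation total := (total b pp s1 F1 s2 F2 H k).
Implicit Types (x y : M -> nat) (i : M).

(** The relation defined by [H] between the two subshifts. *)
Definition related_config x y :=
  [/\ in_shift s1 F1 x, in_shift s2 F2 y & avoids_config H (fun i => pp (x i) (y i))].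

(** The equivalence relation defined by the forbidden pairs [G]. *)
Definition equivalent (G : seq (seq nat)) x x' :=
  avoids_config G (fun i => pair_code (x i) (x' i)).

Lemma related_read x y i L : related_config x y -> related L (read x i) (read y i).
Proof.
move=> [Yx Yy Hxy]; rewrite /related !admissible_read //=.
exact: (@avoids_read _ H (fun i => pp (x i) (y i))).
Qed.

Lemma related_limit (U : set_system nat) (UU : UltraFilter U) g h :
  (forall N, U (fun n => (N <= n)%N)) ->
  U (fun n => related (b * n + n) (g n) (h n)) ->
  exists x y, [/\ related_config x y, word_limit ws U g x & word_limit ws U h y].
Proof.
move=> Uoo Ugh.
have [|x Yx gx] := @word_limit_in_shift _ ws U UU Uoo s1 F1 g.
  by apply: filterS Ugh => n /and3P[].
have [|y Yy hy] := @word_limit_in_shift _ ws U UU Uoo s2 F2 h.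
  by apply: filterS Ugh => n /and3P[].
exists x, y; split=> //; split=> //.
apply: (word_limit_avoids UU Uoo (word_limit_pair UU pp gx hy)).
by apply: filterS Ugh => n /and3P[].
Qed.

Lemma compatible_sound m : (k <= m)%N -> compatible m ->
  forall x y x' y', related_config x y -> related_config x' y' ->
  equivalent G1 x x' -> equivalent G2 y y'.
Proof.
move=> km C x y x' y' R R' E w i wG2.
have := C _ _ _ _ (related_read (i + org m) _ R) (related_read (i + org m) _ R')
  (avoids_read (i + org m) _ E) w wG2.
congr (~~ _); apply: eq_occurs => l _.
by rewrite /read natrD !addrA -(addrA i) win_orgK addr0 add0n.
Qed.

(** Otherwise a limit of counterexamples for growing [m] would be a
    counterexample among configurations. *)
Lemma compatible_complete :
  (forall x y x' y', related_config x y -> related_config x' y' ->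
     equivalent G1 x x' -> equivalent G2 y y') ->
  exists m, compatible (k + m)%N.
Proof.
move=> C; apply: contrapT => /forallNP nC.
have [U [UU Uoo]] := free_ultrafilter.
have /choice[f Hf] n : exists t : (nat -> nat) * (nat -> nat) * (nat -> nat) * (nat -> nat) * nat,
    let: (u, v, u', v', j) := t in (k <= n)%N ->
    [/\ related (b * n + n) u v, related (b * n + n) u' v',
        avoids G1 (b * n + n) (fun j => pair_code (u j) (u' j)),
        (j < size G2)%N &
        occurs (nth [::] G2 j) (fun j => pair_code (v j) (v' j)) (b * n)].
  case: (leqP k n) => [kn|_]; last by exists (id, id, id, id, 0%N).
  have := nC (n - k)%N; rewrite subnKC // => /existsNP[u] /existsNP[v] /existsNP[u'].
  move=> /existsNP[v'] /not_implyP[R] /not_implyP[R'] /not_implyP[A].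
  move=> /existsNP[w] /not_implyP[wG2 /negP]; rewrite negbK => O.
  exists (u, v, u', v', index w G2) => _; split=> //; first by rewrite index_mem.
  by rewrite nth_index.
pose u n := (f n).1.1.1.1; pose v n := (f n).1.1.1.2.
pose u' n := (f n).1.1.2; pose v' n := (f n).1.2; pose j n := (f n).2.
have {}Hf : U (fun n => [/\ related (b * n + n) (u n) (v n), related (b * n + n) (u' n) (v' n),
    avoids G1 (b * n + n) (fun j => pair_code (u n j) (u' n j)), (j n < size G2)%N &
    occurs (nth [::] G2 (j n)) (fun j => pair_code (v n j) (v' n j)) (b * n)]).
  apply: filterS (Uoo k) => n kn; have := Hf n; rewrite /u /v /u' /v' /j.
  by case: (f n) => [[[[]]]] /= ? ? ? ? ? /(_ kn).
have [|x [y [R ux vy]]] := @related_limit U UU u v Uoo.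
  by apply: filterS Hf => n [].
have [|x' [y' [R' ux' vy']]] := @related_limit U UU u' v' Uoo.
  by apply: filterS Hf => n [].
have [|c ltc jc] := @ultra_const U UU j (size G2); first by apply: filterS Hf => n [].
have Exx' : equivalent G1 x x'.
  apply: (word_limit_avoids UU Uoo (word_limit_pair UU pair_code ux ux')).
  by apply: filterS Hf => n [].
have := C _ _ _ _ R R' Exx' _ 0 (mem_nth [::] ltc).
have [n [[[_ _ _ _ O] jn] [i le [i0 E]]]] := filter_ex (filterI (filterI Hf jc)
  (word_limit_read UU Uoo 0 (size (nth [::] G2 c)) (word_limit_pair UU pair_code vy vy'))).
have Ei : i = (b * n)%N by rewrite -(win_idxK ws n i) -i0 -(win_orgK ws n) win_idxK.
move=> /negP; apply; rewrite -jn; move: O; congr is_true.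
by apply: eq_occurs => l ltl; rewrite -E -?jn // Ei.
Qed.

(** The last letters of [v] and of a lift [v'] of [u'] agree, except that [v'] has
    one more letter. This letter extends [v] to a lift of [u], provided that the
    last [k + 1] letters of [u] and [u'] agree. *)
Lemma related_glue n n' u v u' v' : (k <= n)%N -> (k <= n')%N ->
  related n u v -> related n'.+1 u' v' -> admissible s1 F1 n.+1 u ->
  (forall j, (j <= k)%N -> u (n - k + j)%N = u' (n' - k + j)%N) ->
  (forall j, (j < k)%N -> v (n - k + j)%N = v' (n' - k + j)%N) ->
  exists w, [/\ related n.+1 u w, forall j, (j < n)%N -> w j = v j & w n = v' n'].
Proof.
move=> kn kn' /and3P[_ av aH] /and3P[_ av' aH'] au Eu Ev.
pose w j := if (j < n)%N then v j else v' (n' + (j - n))%N.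
have wv j : (j < n)%N -> w j = v j by rewrite /w => ->.
have Ew j : (j < k + 1)%N -> w (n - k + j)%N = v' (n' - k + j)%N.
  rewrite addn1 ltnS leq_eqVlt => /orP[/eqP->|lt]; last by rewrite wv ?Ev //; lia.
  by rewrite /w ifN; [congr v'|]; lia.
exists w; split=> //; last by rewrite /w ltnn subnn addn0.
rewrite -addn1; apply/and3P; split; first by rewrite addn1.
- apply: (@admissible_glue s2 F2 k n n' 1 w v') => //; last by rewrite addn1.
  by rewrite (eq_admissible _ _ wv).
- apply: (@avoids_glue H k n n' 1 _ (fun j => pp (u' j) (v' j))) => //.
  + by rewrite (@eq_avoids _ _ _ (fun j => pp (u j) (v j))) // => j /wv ->.
  + by rewrite addn1.
  + by move=> j ltj; rewrite Ew // Eu //; lia.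
Qed.

(** Every word of the first subshift of length at least [k] is simulated by a word
    of length at most [N]. The simulating word is extended along with the
    simulated one, and replaced by a shorter one when its length exceeds [N]. *)
Lemma total_simulates m N x i n : (k <= N)%N -> total m N -> in_shift s1 F1 x ->
  exists n' e', [/\ (k <= n' <= N)%N, admissible s1 F1 (b * m + n' + m) e' &
    simulates n' (fun j => e' (b * m + j)%N) (k + n) (read x i)].
Proof.
move=> kN [_ T] Yx; set o := (b * m)%N.
elim: n => [|n [n' [e' [/andP[kn' n'N] a' [E S]]]]].
  exists k, (read x (i + org m)); rewrite leqnn kN admissible_read //; split=> //.
  have Er j : read x (i + org m) (o + j)%N = read x i j.
    by rewrite /read natrD !addrA -(addrA i) win_orgK addr0.
  rewrite addn0; split=> [j _|v' R]; first exact: Er.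
  by exists v' => //; rewrite -(eq_related _ _ _ _ _ _ (fun j _ => Er j) (fun j _ => erefl)).
(* The last [m] letters of [e'] are replaced by [m + 1] letters of [x]; this gives
   an admissible word because the two words overlap on [k] letters. *)
pose e j := if (j < o + n')%N then e' j else read x i (k + n + (j - (o + n')))%N.
have ee' j : (j < o + n')%N -> e j = e' j by rewrite /e => ->.
have Ee j : e (o + n' - k + j)%N = read x i (k + n - k + j)%N.
  case: (ltnP j k) => [ltj|lekj].
    by rewrite ee' -?E; [congr e'| |]; lia.
  by rewrite /e ifN; [congr (read x i)|]; lia.
have a : admissible s1 F1 (o + n'.+1 + m) e.
  rewrite (_ : o + n'.+1 + m = o + n' + m.+1)%N; last by lia.
  apply: (@admissible_glue s1 F1 k _ (k + n)%N m.+1 e (read x i)) => //; try by lia.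
  - rewrite (eq_admissible _ _ ee').
    by apply: (@admissible_sub _ _ _ _ _ _ 0%N a') => //; lia.
  - exact: admissible_read.
have {}S : simulates n'.+1 (fun j => e (o + j)%N) (k + n.+1) (read x i).
  split=> [j ltj|v' R].
    rewrite (_ : o + _ = o + n' - k + j.+1)%N ?Ee; last by lia.
    by congr (read x i); lia.
  have [|v Rv Ev] := S v'.
    rewrite (@eq_related _ _ _ _ _ _ n' _ v' (fun j => e (o + j)%N) v') //.
      have := R => /and3P[a1 a2 a3]; apply/and3P; split.
      - by apply: (@admissible_sub _ _ _ _ _ _ 0%N a1) => //; lia.
      - by apply: (@admissible_sub _ _ _ _ _ _ 0%N a2) => //; lia.
      - by apply: (@avoids_sub _ _ _ _ _ 0%N a3) => //; lia.
    by move=> j ltj; rewrite ee' //; lia.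
  have [||||w [Rw wv wn]] := related_glue (n := k + n) (n' := n') _ kn' Rv R.
  - by lia.
  - exact: admissible_read.
  - move=> j lej; rewrite -Ee; congr e; lia.
  - by move=> j ltj; rewrite Ev.
  exists w => [|j ltj]; first by rewrite addnS.
  case: (ltnP j.+1 k) => [lt|ge].
    rewrite (_ : k + n.+1 - k + j = k + n - k + j.+1)%N; last by lia.
    rewrite wv; last by lia.
    by rewrite Ev //; congr v'; lia.
  rewrite (_ : k + n.+1 - k + j = k + n)%N; last by lia.
  rewrite wn.
  by congr v'; lia.
have [lt|ge] := ltnP n' N; first by exists n'.+1, e; split=> //; lia.
have EN : n' = N by lia.
rewrite EN in S a; have [n2 [e2 [n2N a2 [E2 S2]]]] := T e a.
exists n2, e2; split=> //; case: S => ES S; split=> [j ltj|v' /S2[v /S[w Rw Ew] Ev]].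
  by rewrite E2 // ES.
by exists w => // j ltj; rewrite Ew // Ev.
Qed.

Lemma total_sound m N : (k <= N)%N -> total m N ->
  forall x, in_shift s1 F1 x -> exists y, related_config x y.
Proof.
move=> kN T x Yx; have [U [UU Uoo]] := free_ultrafilter.
have /choice[g Hg] n : exists v, related (b * n + n) (read x (org n)) v.
  have [n' [e' [n'N a [_ S]]]] := total_simulates (org n) (b * n + n) kN T Yx.
  have [v' /S[v R _]] := T.1 n' e' n'N a.
  exists v; have /and3P[a1 a2 a3] := R; apply/and3P; split.
  - by apply: (@admissible_sub _ _ _ _ _ _ 0%N a1) => //; lia.
  - by apply: (@admissible_sub _ _ _ _ _ _ 0%N a2) => //; lia.
  - by apply: (@avoids_sub _ _ _ _ _ 0%N a3) => //; lia.
have [|x' [y [R xx' _]]] := @related_limit U UU (fun n => read x (org n)) g Uoo.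
  exact: filterS filterT.
exists y; rewrite (_ : x = x') //; apply/funext => i.
have [N' HN] := win_cover ws i 1.
have [n [/HN[j -> _] <-]] := filter_ex (filterI (Uoo N') (xx' i)).
by rewrite win_idxK.
Qed.

(** For [m] large, a word of length at most [N] with an admissible extension by
    [m] letters is a word of the subshift. *)
Lemma extendable_word s F N : exists m, forall n e, (n <= N)%N ->
  admissible s F (b * m + n + m) e ->
  exists2 x : M -> nat, in_shift s F x & forall j, (j < n)%N -> e (b * m + j)%N = read x 0 j.
Proof.
apply: contrapT => /forallNP nE; have [U [UU Uoo]] := free_ultrafilter.
have /choice[f Hf] m : exists t : nat * (nat -> nat),
    [/\ (t.1 <= N)%N, admissible s F (b * m + t.1 + m) t.2 & ~ exists2 x : M -> nat,
      in_shift s F x & forall j, (j < t.1)%N -> t.2 (b * m + j)%N = read x 0 j].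
  have /existsNP[n] := nE m; move=> /existsNP[e] /not_implyP[nN] /not_implyP[a nx].
  by exists (n, e).
have [|x Yx ex] := @word_limit_in_shift _ ws U UU Uoo s F (fun m => (f m).2).
  apply: filterS filterT => m _; have [_ a _] := Hf m.
  by apply: (@admissible_sub _ _ _ _ _ _ 0%N a) => //; lia.
have [m [i le [i0 E]]] := filter_ex (word_limit_read UU Uoo 0 N ex).
have Ei : i = (b * m)%N by rewrite -(win_idxK ws m i) -i0 -(win_orgK ws m) win_idxK.
have [nN _] := Hf m; apply; exists x => // j ltj.
by rewrite -E -?Ei //; lia.
Qed.

Lemma finitely_many_types (T : finType) (D : Type) (P : D -> Prop) (ty : D -> T)
  (len : D -> nat) : exists N, forall d, P d ->
  exists d', [/\ P d', ty d' = ty d & (len d' <= N)%N].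
Proof.
have /choice[n Hn] t : exists n, forall d, P d -> ty d = t ->
    exists d', [/\ P d', ty d' = t & (len d' <= n)%N].
  have [[d [Pd td]]|nd] := pselect (exists d, P d /\ ty d = t).
    by exists (len d) => d' _ _; exists d.
  by exists 0%N => d Pd td; case: nd; exists d.
exists (\max_t n t)%N => d Pd; have [d' [Pd' E le]] := Hn (ty d) d Pd erefl.
by exists d'; split=> //; apply: leq_trans le (leq_bigmax _).
Qed.

(** The last [k] letters of a word of length [n]. *)
Definition last_letters (s n : nat) (g : nat -> nat) : k.-tuple 'I_s.+1 :=
  [tuple inord (g (n - k + j)%N) | j < k].

Lemma last_lettersP s n n' g g' : (k <= n)%N -> (k <= n')%N ->
  (forall j, (j < n)%N -> (g j < s)%N) -> (forall j, (j < n')%N -> (g' j < s)%N) ->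
  last_letters s n g = last_letters s n' g' <->
  forall j, (j < k)%N -> g (n - k + j)%N = g' (n' - k + j)%N.
Proof.
move=> kn kn' bg bg'; split=> [E j ltj|E]; last first.
  by apply: eq_from_tnth => j; rewrite !tnth_mktuple E.
have := congr1 (fun t => val (tnth t (Ordinal ltj))) E; rewrite !tnth_mktuple /=.
by rewrite !inordK // ltnS ltnW //; [apply: bg' | apply: bg]; lia.
Qed.

Lemma total_complete :
  (forall x, in_shift s1 F1 x -> exists y, related_config x y) ->
  exists m N, total m (k + N)%N.
Proof.
move=> S.
(* The type of a word: its last letters and the last letters of its lifts. *)
pose ty (d : (M -> nat) * nat) := (last_letters s1 d.2 (read d.1 0),
  [set t | `[< exists2 v, related d.2 (read d.1 0) v & last_letters s2 d.2 v = t >]]).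
have [N HN] := finitely_many_types
  (fun d : (M -> nat) * nat => in_shift s1 F1 d.1 /\ (k <= d.2)%N) ty snd.
have [m Hm] := extendable_word s1 F1 (k + N).+1; exists m, N; split.
  move=> n e /andP[_ nN] /Hm[|x Yx E]; first by lia.
  have [y R] := S x Yx; exists (read y 0).
  by rewrite (eq_related _ _ _ _ _ _ E (fun _ _ => erefl)); exact: related_read.
move=> e /Hm[//|x Yx E].
have [|[x' n] [[Yx' kn] Ety nN]] := HN (x, (k + N).+1); first by split=> //=; lia.
have El : last_letters s1 n (read x' 0) = last_letters s1 (k + N).+1 (read x 0).
  exact: (congr1 fst Ety).
have Es : (ty (x', n)).2 = (ty (x, (k + N).+1)).2 by rewrite Ety.
rewrite /= in Yx' kn nN.
have bx z j : in_shift s1 F1 z -> (read z 0 j < s1)%N by case=> bz _; exact: bz.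
have bv l u v j : related l u v -> (j < l)%N -> (v j < s2)%N.
  by move=> /and3P[_ /andP[/boundedP + _] _]; apply.
exists n, (read x' (org m)).
have Er j : read x' (org m) (b * m + j)%N = read x' 0 j.
  by rewrite /read natrD addrA win_orgK.
split=> [||]; first by lia.
  exact: admissible_read.
split=> [j ltj|v' R'].
  rewrite Er E; last by lia.
  by apply: (last_lettersP _ _ _ _).1 El _ ltj => //; [lia | move=> *; exact: bx..].
rewrite (eq_related _ _ _ _ _ _ (fun j _ => Er j) (fun _ _ => erefl)) in R'.
have : last_letters s2 n v' \in (ty (x', n)).2.
  by rewrite inE; apply/asboolP; exists v'.
rewrite Es inE => /asboolP[v R Ev]; exists v.
  by rewrite (eq_related _ _ _ _ _ _ E (fun _ _ => erefl)).
apply: (@last_lettersP s2 (k + N).+1 n v v' _ kn _ _).1 Ev => [|j|j]; first by lia.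
- exact: bv R.
- exact: bv R'.
Qed.

End Relation.

Program Definition nat_windows : windows nat :=
  @Windows nat 0 (fun=> 0) (fun _ i => i) _ _ _.
Next Obligation. by move=> n; rewrite mul0n. Qed.
Next Obligation. by move=> n j; rewrite add0r natn. Qed.
Next Obligation.
by move=> i L; exists (i + L)%N => n le; exists i; rewrite ?add0r ?natn ?mul0n.
Qed.

Program Definition int_windows : windows int :=
  @Windows int 1 (fun n => - n%:R) (fun n i => absz (i + n%:R)) _ _ _.
Next Obligation. by move=> n; rewrite mul1n addNr. Qed.
Next Obligation. by move=> n j; rewrite !natz; lia. Qed.
Next Obligation.
move=> i L; exists (absz i + L)%N => n le; exists (absz (i + n%:R)); rewrite !natz; lia.
Qed.

(** * Points of a presented system *)

Section ConfigTopology.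
Variables (M : pzSemiRingType) (A : finType).
Implicit Types (x : config M A).

(** Pointwise eventual equality along a filter implies convergence. *)
Lemma config_cvg (U : set_system nat) (FU : Filter U) (z : nat -> config M A) x :
  (forall i, U (fun n => z n i = x i)) -> forall B, nbhs x B -> U (fun n => B (z n)).
Proof.
move=> H; suff : (z @ U --> x)%classic by apply.
have FF : Filter (z @ U)%classic by exact: fmap_filter.
apply/cvg_sup => i B [_ [[C Cop <-] Cx] sub].
by apply: (@filterS _ U FU _ _ _ (H i)) => n zn; apply: sub; rewrite /= zn.
Qed.

Lemma config_nbhs (L : nat) (f : nat -> M) x :
  nbhs x (fun z : config M A => forall l, (l < L)%N -> z (f l) = x (f l)).
Proof.
elim: L => [|L IH]; first by apply: filterS filterT.
have H : nbhs x (fun z : config M A => z (f L) = x (f L)).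
  apply: (@proj_continuous M (fun=> discrete_topology A) (f L) x (fun a => a = x (f L))).
  by rewrite nbhs_principalE.
apply: filterS2 IH H => z H1 H2 l.
by rewrite ltnS leq_eqVlt => /orP[/eqP->|/H1].
Qed.

End ConfigTopology.

Section Points.
Variables (M : pzSemiRingType) (ws : windows M) (P : presentation M).
Local Notation b := (win_left ws).
Local Notation org := (win_org ws).
Implicit Types (y z : Yspace P).

(** The forbidden words of a presentation, as words over the natural numbers. *)
Definition forbidden_words : seq (seq nat) := [seq [seq val a | a <- w] | w <- forbY P].

(** The forbidden words for the equivalence relation, over the codes of pairs. *)
Definition forbidden_pairs : seq (seq nat) :=
  [seq [seq pair_code (val ab.1) (val ab.2) | ab <- w] | w <- forbZ P].

(** The three entries of the code of a presentation. *)
Lemma letter_code_alph : letter (code_presentation P) 0 = alph P.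
Proof. by rewrite /letter CodeSeq.codeK. Qed.

Lemma wordlist_code (W : seq (seq nat)) :
  wordlist (CodeSeq.code [seq CodeSeq.code w | w <- W]) = W.
Proof.
rewrite /wordlist CodeSeq.codeK -map_comp -[RHS]map_id.
by apply: eq_map => w; exact: CodeSeq.codeK.
Qed.

Lemma wordlist_code_words : wordlist (letter (code_presentation P) 1) = forbidden_words.
Proof.
rewrite -[RHS]wordlist_code /letter CodeSeq.codeK /= /forbidden_words -map_comp.
by congr (wordlist (CodeSeq.code _)); apply: eq_map.
Qed.

Lemma wordlist_code_pairs : wordlist (letter (code_presentation P) 2) = forbidden_pairs.
Proof.
rewrite -[RHS]wordlist_code /letter CodeSeq.codeK /= /forbidden_pairs -map_comp.
by congr (wordlist (CodeSeq.code _)); apply: eq_map.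
Qed.

(** The configuration of natural numbers underlying a point. *)
Definition nconf y : M -> nat := fun i => nat_of_ord (set_val y i : 'I_(alph P)).

(** An injective renaming of letters into the natural numbers turns the
    membership in a subshift of finite type into avoidance. *)
Lemma sft_occurs (A : finType) (f : A -> nat) (F : seq (seq A)) (x : config M A) :
  injective f -> sft F x <-> avoids_config [seq [seq f a | a <- w] | w <- F] (f \o x).
Proof.
move=> f_inj.
suff E w i : subword x i (size w) = w <-> occurs [seq f a | a <- w] (read (f \o x) i) 0.
  split=> [Fx _ i /mapP[w wF ->]|Fx w wF i /E].
    by apply/negP => /E; exact: Fx.
  by apply/negP; apply: Fx; exact: map_f.
split=> [<-|/occursP].
  apply/occursP => l; rewrite size_map /subword size_map size_iota => ltl.
  by rewrite -map_comp (nth_map 0%N) ?size_iota // nth_iota.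
rewrite size_map => H.
apply: (inj_map f_inj); apply: (@eq_from_nth _ 0%N).
  by rewrite !size_map size_iota.
rewrite /subword !size_map size_iota => l ltl; rewrite -H // -map_comp.
by rewrite (nth_map 0%N) ?size_iota // nth_iota.
Qed.

Lemma nconf_in_shift y : in_shift (alph P) forbidden_words (nconf y).
Proof.
split=> [i|]; first exact: ltn_ord.
have /set_mem /(sft_occurs _ _ (@ord_inj _)) := valP y.
exact.
Qed.

Lemma nconf_surj x : in_shift (alph P) forbidden_words x -> exists y, nconf y = x.
Proof.
move=> [bx Fx]; pose x' : config M 'I_(alph P) := fun i => Ordinal (bx i).
have Fx' : sft (forbY P) x' by apply/(sft_occurs _ _ (@ord_inj _)).
by exists (exist _ x' (mem_set Fx')); exact/funext.
Qed.

Lemma pair_code_inj a b a' b' : pair_code a b = pair_code a' b' -> a = a' /\ b = b'.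
Proof. by move=> /(can_inj CodeSeq.codeK)[-> ->]. Qed.

Lemma class_of_eq y z :
  class_of y = class_of z <-> equivalent forbidden_pairs (nconf y) (nconf z).
Proof.
have inj : injective (fun ab : 'I_(alph P) * 'I_(alph P) => pair_code (val ab.1) (val ab.2)).
  by move=> [a1 a2] [b1 b2] /= /pair_code_inj[/ord_inj-> /ord_inj->].
have E := sft_occurs (forbZ P) (fun i => (val y i, val z i)) inj.
split=> [/eqmodP /= /asboolP /E //|H].
by apply/eqmodP => /=; apply/asboolP/E.
Qed.

Lemma nconf_shift m y : nconf (Yshift m y) = fun i => nconf y (m + i).
Proof. by []. Qed.

(** The points [z n] converge to [y] along [U]. *)
Definition tends (U : set_system nat) (z : nat -> Yspace P) y :=
  forall i, U (fun n => nconf (z n) i = nconf y i).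

Lemma tends_open (U : set_system nat) (FU : Filter U) (z : nat -> Yspace P) y
    (O : set (Yspace P)) :
  tends U z y -> open O -> O y -> U (fun n => O (z n)).
Proof.
move=> zy [V Vop <-] Vy.
apply: (config_cvg FU (z := fun n => set_val (z n)) (x := set_val y)).
  by move=> i; apply: filterS (zy i) => n /ord_inj.
by apply: open_nbhs_nbhs; split.
Qed.

Lemma tends_cst (U : set_system nat) (FU : Filter U) y : tends U (fun=> y) y.
Proof. by move=> i; apply: filterS filterT. Qed.

(** [y] and [z] agree on the [n]-th window. *)
Definition agree n y z :=
  forall l, (l < b * n + n)%N -> nconf z (org n + l%:R) = nconf y (org n + l%:R).

Lemma agree_tends (U : set_system nat) (FU : Filter U) (z : nat -> Yspace P) y :
  (forall N, U (fun n => (N <= n)%N)) -> (forall n, agree n y (z n)) -> tends U z y.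
Proof.
move=> Uoo H i; have [N HN] := win_cover ws i 1.
by apply: filterS (Uoo N) => n /HN[j -> lt]; apply: H; lia.
Qed.

(** The cylinders over windows are open: a set is open when its complement is
    sequentially closed. *)
Lemma open_agree (O : set (Yspace P)) :
  (forall y (z : nat -> Yspace P), O y -> (forall n, agree n y (z n)) -> exists n, O (z n)) ->
  open O.
Proof.
move=> H; rewrite openE => y Oy.
have [n Hn] : exists n, forall z, agree n y z -> O z.
  apply: contrapT => /forallNP nH.
  have /choice[z Hz] n : exists z, agree n y z /\ ~ O z.
    by have /existsNP[z /not_implyP Hz] := nH n; exists z.
  have [n] := H y z Oy (fun n => (Hz n).1).
  by have [] := Hz n.
have Hy : nbhs y (fun z => forall l, (l < b * n + n)%N ->
    set_val z (org n + l%:R) = set_val y (org n + l%:R)).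
  have C : continuous (set_val : Yspace P -> config M 'I_(alph P)).
    exact: initial_continuous.
  exact: (C y _ (@config_nbhs M _ (b * n + n) (fun l => org n + l%:R) (set_val y))).
apply: (@filterS _ _ _ _ _ _ Hy) => z Hz; apply: Hn => l ltl.
by rewrite /nconf Hz.
Qed.

Variables (U : set_system nat) (UU : UltraFilter U).

Lemma avoids_config_limit F (x : nat -> M -> nat) (x' : M -> nat) :
  (forall i, U (fun n => x n i = x' i)) -> U (fun n => avoids_config F (x n)) ->
  avoids_config F x'.
Proof.
move=> xx' Fx w i wF.
have H := ultra_forall UU (fun l (_ : (l < size w)%N) => xx' (i + l%:R)).
have [n [Fn E]] := filter_ex (filterI Fx H).
by rewrite (@eq_occurs _ _ _ (read (x n) i) 0%N) ?Fn // => l ltl; rewrite /read E.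
Qed.

(** The subshift is compact. *)
Lemma tends_exists (z : nat -> Yspace P) : exists y, tends U z y.
Proof.
have [|x bx zx] := @ultra_config U UU M (fun n => nconf (z n)) (alph P).
  by move=> i; apply: filterS filterT => n _; exact: ltn_ord.
have [|y Ey] := @nconf_surj x; last by exists y; rewrite /tends Ey.
split=> //; apply: avoids_config_limit zx _; apply: filterS filterT => n _.
by have [] := nconf_in_shift (z n).
Qed.

(** The equivalence relation of a presentation is closed. *)
Lemma class_of_limit (z z' : nat -> Yspace P) y y' : tends U z y -> tends U z' y' ->
  U (fun n => class_of (z n) = class_of (z' n)) -> class_of y = class_of y'.
Proof.
move=> zy z'y' E; apply/class_of_eq.
apply: (@avoids_config_limit _ (fun n i => pair_code (nconf (z n) i) (nconf (z' n) i))).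
  by move=> i; apply: filterS2 (zy i) (z'y' i) => n -> ->.
by apply: filterS E => n /class_of_eq.
Qed.

End Points.

Local Open Scope quotient_scope.

(** * Conjugacies as relations *)

(** A relation [R] between the points of two subshifts that induces a map between
    the quotients. *)
Section MapRelations.
Variables (M : pzSemiRingType) (P1 P2 : presentation M).
Implicit Types (R : Yspace P1 -> Yspace P2 -> Prop).

Definition rel_total R := forall y, exists z, R y z.

Definition rel_functional R := forall y z y' z', R y z -> R y' z' ->
  class_of y = class_of y' -> class_of z = class_of z'.

(** [R] is closed under limits along free ultrafilters. *)
Definition rel_closed R := forall U : set_system nat, UltraFilter U ->
  (forall N, U (fun n => (N <= n)%N)) -> forall yn zn y z,
  tends U yn y -> tends U zn z -> U (fun n => R (yn n) (zn n)) -> R y z.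

Definition rel_shift R := forall m y z, R y z -> R (Yshift m y) (Yshift m z).

(** Continuity holds because the graph of the induced map is closed and the
    second subshift is compact. *)
Lemma induced_map (ws : windows M) R : rel_total R -> rel_functional R -> rel_closed R ->
  exists2 f : YmodZ P1 -> YmodZ P2, continuous f &
    forall y z, R y z -> f (class_of y) = class_of z.
Proof.
move=> /choice[F RF] Rfun Rcl.
have /choice[s sK] := @class_of_surj M P1.
have fE y z : R y z -> class_of (F (s (class_of y))) = class_of z.
  by move=> Ryz; apply: Rfun (RF _) Ryz _; exact: sK.
exists (fun c => class_of (F (s c))) => //.
apply/(@quotient_continuous (Yspace P1) {eq_quot (Zrel P1)})/continuousP => O Oop.
apply: (@open_agree M ws P1 (fun y => O (class_of (F (s (class_of y)))))) => y yn Oy Hyn.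
apply: contrapT => /forallNP nO.
have [U [UU Uoo]] := free_ultrafilter.
have yny : tends U yn y by exact: agree_tends Hyn.
have [z znz] := tends_exists UU (fun n => F (yn n)).
have Ryz : R y z.
  by apply: (Rcl U UU Uoo _ _ _ _ yny znz); apply: filterS filterT => n _; exact: RF.
have Op : open (fun z => O (class_of z : YmodZ P2)).
  by have /continuousP := @pi_continuous (Yspace P2) {eq_quot (Zrel P2)}; apply.
have Oz : O (class_of z) by rewrite -(fE y z).
have [n] := filter_ex (tends_open _ znz Op Oz).
by rewrite -(fE (yn n) _ (RF _)); exact: nO.
Qed.

End MapRelations.

Section Conjugacy.
Variables (M : pzSemiRingType) (ws : windows M) (P1 P2 : presentation M).
Local Notation b := (win_left ws).
Local Notation org := (win_org ws).

Lemma relation_conjugate (R : Yspace P1 -> Yspace P2 -> Prop) :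
  let R' z y := R y z in
  rel_total R -> rel_total R' -> rel_functional R -> rel_functional R' ->
  rel_closed R -> rel_shift R -> conjugate (system_of P1) (system_of P2).
Proof.
move=> R' T T' F F' Rc Rs.
have Rc' : rel_closed R' by move=> U UU Uoo yn zn y z Hy Hz; exact: Rc.
have [f fc fE] := induced_map ws T F Rc.
have [g gc gE] := induced_map ws T' F' Rc'.
exists f, g; split=> // [c|c|m c].
- have [y <-] := class_of_surj c; have [z Ryz] := T y.
  by rewrite (fE _ _ Ryz) (gE z y).
- have [z <-] := class_of_surj c; have [y Ryz] := T' z.
  by rewrite (gE _ _ Ryz) (fE y z).
- have [y <-] := class_of_surj c; have [z Ryz] := T y.
  rewrite /= (fE _ _ Ryz) !YmodZ_shiftE.
  by apply: fE; exact: Rs.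
Qed.

(** The graph of a continuous map between the quotients lifts to a closed
    relation, because the classes that meet a given cylinder form a closed set. *)
Lemma graph_closed (h : YmodZ P1 -> YmodZ P2) : continuous h ->
  rel_closed (fun y z => h (class_of y) = class_of z).
Proof.
move=> hc U UU Uoo yn zn y z yny znz Ryz; apply: contrapT => nE.
have [a Ea] := class_of_surj (h (class_of y)).
have [j Hj] : exists j, forall k, agree ws j z k -> class_of k <> class_of a.
  apply: contrapT => /forallNP nH.
  have /choice[k Hk] j : exists k, agree ws j z k /\ class_of k = class_of a.
    by have /existsNP[k /not_implyP[? /contrapT]] := nH j; exists k.
  apply: nE; rewrite -Ea; apply/esym.
  apply: (class_of_limit UU (z := k) (z' := fun=> a)).
  - by apply: (@agree_tends _ ws) => // n; have [] := Hk n.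
  - exact: tends_cst.
  - by apply: filterS filterT => n _; have [] := Hk n.
(* The set of the classes that do not meet the cylinder of [z]. *)
pose O := (fun c => forall k, agree ws j z k -> class_of k <> c) : set (YmodZ P2).
have Oop : open O.
  apply: (@open_agree M ws P2 (fun y => O (class_of y))) => y0 wn Oy0 Hwn.
  apply: contrapT => /forallNP nO.
  have /choice[k Hk] n : exists k, agree ws j z k /\ class_of k = class_of (wn n).
    by have /existsNP[k /not_implyP[? /contrapT]] := nO n; exists k.
  have [V [VV Voo]] := free_ultrafilter.
  have wy0 : tends V wn y0 by exact: agree_tends Hwn.
  have [k0 kk0] := tends_exists VV k.
  apply: (Oy0 k0); last first.
    by apply: (class_of_limit VV kk0 wy0); apply: filterS filterT => n _; have [] := Hk n.
  move=> l ltl; have [n <-] := filter_ex (kk0 (org j + l%:R)).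
  by have [/(_ l ltl)] := Hk n.
have Pop : open (fun y => O (h (class_of y))).
  have /continuousP hc' := hc.
  have /continuousP pc := @pi_continuous (Yspace P1) {eq_quot (Zrel P1)}.
  exact: (pc _ (hc' _ Oop)).
have Oy : O (h (class_of y)) by rewrite -Ea.
have H1 : U (fun n => O (h (class_of (yn n)))) by exact: tends_open yny Pop Oy.
have H2 := ultra_forall UU (fun l (_ : (l < b * j + j)%N) => znz (org j + l%:R)).
have [n [[On Zn] En]] := filter_ex (filterI (filterI H1 H2) Ryz).
by apply: (On (zn n)).
Qed.

End Conjugacy.

Section FiniteType.
Variables (M : pzSemiRingType) (ws : windows M) (P1 P2 : presentation M).
Local Notation b := (win_left ws).
Local Notation org := (win_org ws).
Variable R : Yspace P1 -> Yspace P2 -> Prop.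
Hypotheses (Rtotal : rel_total R) (Rfun : rel_functional R) (Rclosed : rel_closed R)
  (Rshift : rel_shift R).
(* [R] is saturated for the equivalence of the second presentation. *)
Hypothesis Rsat : forall y z z', R y z -> class_of z = class_of z' -> R y z'.

Lemma agree_tends_seq (P : presentation M) (U : set_system nat) (UU : Filter U)
    (yn zn : nat -> Yspace P) y :
  (forall N, U (fun n => (N <= n)%N)) -> (forall n, agree ws n (yn n) (zn n)) ->
  tends U yn y -> tends U zn y.
Proof.
move=> Uoo H Hy i; have [N HN] := win_cover ws i 1.
apply: filterS2 (Uoo N) (Hy i) => n /HN[j Ei lt] <-.
by rewrite Ei; apply: H; lia.
Qed.

(** Two points are related as soon as each of their windows of a certain length
    is a window of related points. The second system is expansive: two points are
    equivalent when no forbidden pair is seen anywhere, so that a limit of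
    counterexamples, shifted to show a forbidden pair at the position 0, is a
    counterexample to functionality. *)
Lemma relation_local : exists n, forall y z,
  (forall m, exists y' z',
     [/\ R y' z', agree ws n y' (Yshift m y) & agree ws n z' (Yshift m z)]) ->
  R y z.
Proof.
apply: contrapT => /forallNP nH; have [U [UU Uoo]] := free_ultrafilter.
have /choice[f Hf] n :
    exists t : Yspace P1 * Yspace P2 * Yspace P2 * Yspace P1 * Yspace P2 * seq nat,
    let: (y, z, a, y', z', w) := t in
    [/\ R y a, R y' z', agree ws n y' y, agree ws n z' z &
      w \in forbidden_pairs P2 /\
      occurs w (read (fun i => pair_code (nconf a i) (nconf z i)) 0) 0].
  have /existsNP[y /existsNP[z /not_implyP[loc nR]]] := nH n.
  have [a Rya] := Rtotal y.
  have /class_of_eq/existsNP[w /existsNP[i /not_implyP[wG /negP]]] : class_of a <> class_of z.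
    by move=> E; apply: nR; exact: Rsat E.
  rewrite negbK => O; have [y' [z' [R' Ay Az]]] := loc i.
  exists (Yshift i y, Yshift i z, Yshift i a, y', z', w); split=> //; first exact: Rshift.
  split=> //; move: O; congr is_true; apply: eq_occurs => l _.
  by rewrite /read /= !nconf_shift add0r.
pose yn n := (f n).1.1.1.1.1; pose zn n := (f n).1.1.1.1.2; pose an n := (f n).1.1.1.2.
pose y'n n := (f n).1.1.2; pose z'n n := (f n).1.2; pose wn n := (f n).2.
have {}Hf n : [/\ R (yn n) (an n), R (y'n n) (z'n n), agree ws n (y'n n) (yn n),
    agree ws n (z'n n) (zn n) & wn n \in forbidden_pairs P2 /\
    occurs (wn n) (read (fun i => pair_code (nconf (an n) i) (nconf (zn n) i)) 0) 0].
  by have := Hf n; rewrite /yn /zn /an /y'n /z'n /wn; case: (f n) => [[[[[]]]]].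
have [y y'y] := tends_exists UU y'n.
have [z z'z] := tends_exists UU z'n.
have [a ana] := tends_exists UU an.
have yny : tends U yn y by apply: agree_tends_seq y'y => // n; have [] := Hf n.
have znz : tends U zn z by apply: agree_tends_seq z'z => // n; have [] := Hf n.
have Ryz : R y z.
  by apply: (Rclosed UU Uoo y'y z'z); apply: filterS filterT => n _; have [] := Hf n.
have Rya : R y a.
  by apply: (Rclosed UU Uoo yny ana); apply: filterS filterT => n _; have [] := Hf n.
have /class_of_eq E := Rfun Rya Ryz erefl.
pose L := (\max_(w <- forbidden_pairs P2) size w)%N.
have Ha := ultra_forall UU (fun l (_ : (l < L)%N) => ana (l%:R)).
have Hz := ultra_forall UU (fun l (_ : (l < L)%N) => znz (l%:R)).
have [n [Ea Ez]] := filter_ex (filterI Ha Hz).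
have [_ _ _ _ [wG O]] := Hf n; have /negP := E _ 0 wG; apply; move: O.
congr is_true; apply: eq_occurs => l ltl.
have ltL : (l < L)%N.
  apply: leq_trans ltl _.
  exact: (@leq_bigmax_seq _ _ xpredT (fun w : seq nat => size w) _ wG isT).
by rewrite /read !add0r !add0n Ea ?Ez.
Qed.

(** The relation is a subshift of finite type: the forbidden words are the pairs
    of words, of the length of a suitable window, not seen in related points. *)
Lemma relation_sft : exists H : seq (seq nat), forall y z,
  R y z <-> avoids_config H (fun i => pair_code (nconf y i) (nconf z i)).
Proof.
have [n Hn] := relation_local; pose L := (b * n + n)%N.
pose seen (t : L.-tuple ('I_(alph P1) * 'I_(alph P2))) := exists y z, R y z /\
  forall l : 'I_L, set_val y (org n + l%:R) = (tnth t l).1 /\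
                   set_val z (org n + l%:R) = (tnth t l).2.
pose word (t : L.-tuple ('I_(alph P1) * 'I_(alph P2))) :=
  [seq pair_code (val ab.1) (val ab.2) | ab <- t].
exists [seq word t | t <- enum {: L.-tuple ('I_(alph P1) * 'I_(alph P2))} & ~~ `[< seen t >]].
have org0 i l : org n + (i + (b * n)%:R + l) = i + l.
  by rewrite [i + _]addrC addrA addrA win_orgK add0r.
move=> y z; split=> [Ryz|Hyz].
  move=> w i /mapP[t]; rewrite mem_filter => /andP[/asboolP nseen _] ->.
  apply/negP => /occursP; rewrite size_map size_tuple => O; apply: nseen.
  exists (Yshift (i + (b * n)%:R) y), (Yshift (i + (b * n)%:R) z).
  split; first exact: Rshift.
  move=> l; have := O l (ltn_ord l).
  have ltl : (l < size t)%N by rewrite size_tuple.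
  rewrite (nth_map (tnth t l)) // -tnth_nth add0n => /pair_code_inj[E1 E2].
  have Em : i + (b * n)%:R + (org n + l%:R) = i + l%:R.
    by rewrite [_ + (org n + _)]addrCA org0.
  by split; apply: ord_inj; [rewrite -E1|rewrite -E2]; exact: (congr1 (nconf _) Em).
apply: Hn => m.
pose t := [tuple (set_val y (m + (org n + (l : 'I_L)%:R)) : 'I_(alph P1),
                  set_val z (m + (org n + l%:R)) : 'I_(alph P2)) | l < L].
have [/asboolP[y' [z' [R' E]]]|nseen] := boolP `[< seen t >].
  exists y', z'; split=> // l ltl; have [E1 E2] := E (Ordinal ltl).
    by rewrite nconf_shift /nconf E1 tnth_mktuple.
  by rewrite nconf_shift /nconf E2 tnth_mktuple.
have tH : word t \in [seq word t | t <- enum {: L.-tuple ('I_(alph P1) * 'I_(alph P2))}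
    & ~~ `[< seen t >]].
  by apply: map_f; rewrite mem_filter nseen mem_enum.
have /negP[] := Hyz _ (m + org n) tH; apply/occursP => l; rewrite size_map size_tuple => ltl.
rewrite (nth_map (tnth t (Ordinal ltl))) ?size_tuple // -(tnth_nth _ t (Ordinal ltl)).
by rewrite tnth_mktuple add0n /read /nconf addrA.
Qed.

End FiniteType.

(** * Conjugacy is semidecidable *)

Section HalfCheck.
Variables (M : pzSemiRingType) (ws : windows M) (P1 P2 : presentation M).
Variables (pp : nat -> nat -> nat) (h k : nat).
Local Notation c1 := (code_presentation P1).
Local Notation c2 := (code_presentation P2).
Hypotheses (c1k : (c1 <= k)%N) (c2k : (c2 <= k)%N) (hk : (h <= k)%N).
Local Notation related_points := (related_config pp
  (alph P1) (forbidden_words P1) (alph P2) (forbidden_words P2) (wordlist h)).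
Local Notation half_check := (half_check (win_left ws) pp c1 c2 h k).

Let F1k (w : seq nat) : w \in forbidden_words P1 -> (size w <= k)%N.
Proof.
rewrite -wordlist_code_words => /size_wordlist /leq_trans; apply.
exact: leq_trans (letter_leq _ _) c1k.
Qed.

Let F2k (w : seq nat) : w \in forbidden_words P2 -> (size w <= k)%N.
Proof.
rewrite -wordlist_code_words => /size_wordlist /leq_trans; apply.
exact: leq_trans (letter_leq _ _) c2k.
Qed.

Let G2k (w : seq nat) : w \in forbidden_pairs P2 -> (size w <= k)%N.
Proof.
rewrite -wordlist_code_pairs => /size_wordlist /leq_trans; apply.
exact: leq_trans (letter_leq _ _) c2k.
Qed.

Let Hk (w : seq nat) : w \in wordlist h -> (size w <= k)%N.
Proof. by move=> /size_wordlist /leq_trans; apply. Qed.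

Definition total_relation (r : (M -> nat) -> (M -> nat) -> Prop) :=
  forall x, in_shift (alph P1) (forbidden_words P1) x -> exists y, r x y.

Definition functional_relation (r : (M -> nat) -> (M -> nat) -> Prop) :=
  forall x y x' y', r x y -> r x' y' ->
  equivalent (forbidden_pairs P1) x x' -> equivalent (forbidden_pairs P2) y y'.

Lemma half_check_sound m m' N : half_check (k + m) m' (k + N) ->
  total_relation related_points /\ functional_relation related_points.
Proof.
rewrite /half_check !letter_code_alph !wordlist_code_words !wordlist_code_pairs.
have km : (k <= k + m)%N by exact: leq_addr.
have G2m w : w \in forbidden_pairs P2 -> (size w <= k + m)%N.
  by move=> /G2k le; exact: leq_trans le km.
move=> /andP[/(compatibleP _ _ _ _ _ _ _ _ G2m) C /(totalP _ _ _ _ _ _ _ _ (leq_addr _ _)) T].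
split; last exact: compatible_sound km C.
by move=> x Yx; exact (total_sound F1k F2k Hk (leq_addr N k) T Yx).
Qed.

Lemma half_check_complete : total_relation related_points ->
  functional_relation related_points ->
  exists m m' N, half_check (k + m) m' (k + N).
Proof.
move=> /(total_complete ws k)[m' [N T]] /(compatible_complete ws k)[m C].
exists m, m', N.
rewrite /half_check !letter_code_alph !wordlist_code_words !wordlist_code_pairs.
apply/andP; split; last by apply/totalP => //; exact: leq_addr.
by apply/compatibleP => // w /G2k le; exact: leq_trans le (leq_addr _ _).
Qed.

End HalfCheck.

Section Main.
Variables (M : pzSemiRingType) (ws : windows M) (P1 P2 : presentation M).
Local Notation c1 := (code_presentation P1).
Local Notation c2 := (code_presentation P2).

Lemma related_config_swap s1 F1 s2 F2 H (x y : M -> nat) :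
  related_config (fun a b => pair_code b a) s2 F2 s1 F1 H y x <->
  related_config pair_code s1 F1 s2 F2 H x y.
Proof. by split=> -[? ? ?]; split. Qed.

Lemma avoids_config_shift F (x : M -> nat) m :
  avoids_config F x -> avoids_config F (fun i => x (m + i)).
Proof.
move=> Fx w i wF; have := Fx w (m + i) wF; congr (~~ _).
by apply: eq_occurs => l _; rewrite /read addrA.
Qed.

Lemma check_sound t : check (win_left ws) c1 c2 t ->
  conjugate (system_of P1) (system_of P2).
Proof.
rewrite /check; set h := letter t 0; set k := (c1 + c2 + h)%N.
have [c1k c2k hk] : [/\ (c1 <= k)%N, (c2 <= k)%N & (h <= k)%N] by rewrite /k; split; lia.
move=> /andP[/(half_check_sound c1k c2k hk)[T F]].
move=> /(half_check_sound c2k c1k hk)[T' F'].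
apply: (relation_conjugate ws (R := fun y z => related_config pair_code
  (alph P1) (forbidden_words P1) (alph P2) (forbidden_words P2) (wordlist h)
  (nconf y) (nconf z))).
- move=> y; have [z' Rz] := T _ (nconf_in_shift y).
  by have [_ /nconf_surj[z Ez] _] := Rz; exists z; rewrite Ez.
- move=> z; have [y' /related_config_swap Ry] := T' _ (nconf_in_shift z).
  by have [/nconf_surj[y Ey] _ _] := Ry; exists y; rewrite Ey.
- by move=> y z y' z' R R' /class_of_eq E; apply/class_of_eq; exact: F R R' E.
- move=> z y z' y' /related_config_swap R /related_config_swap R' /class_of_eq E.
  by apply/class_of_eq; exact: F' R R' E.
- move=> U UU Uoo yn zn y z yny znz Rn; split; try exact: nconf_in_shift.
  apply: (avoids_config_limit UU (x := fun n i => pair_code (nconf (yn n) i) (nconf (zn n) i))).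
    by move=> i; apply: filterS2 (yny i) (znz i) => n -> ->.
  by apply: filterS Rn => n [].
- move=> m y z [_ _ H]; split; try exact: nconf_in_shift.
  exact: (@avoids_config_shift _ (fun i => pair_code (nconf y i) (nconf z i)) m).
Qed.

Lemma check_complete : conjugate (system_of P1) (system_of P2) ->
  exists t, check (win_left ws) c1 c2 t.
Proof.
move=> [f [g [fK gK fc gc fact]]].
pose R (y : Yspace P1) (z : Yspace P2) := f (class_of y) = class_of z.
have Rtotal : rel_total R.
  by move=> y; have [z Ez] := class_of_surj (f (class_of y)); exists z.
have Rfun : rel_functional R by move=> y z y' z' <- <- ->.
have Rsat y z z' : R y z -> class_of z = class_of z' -> R y z' by rewrite /R => ->.
have Rshift : rel_shift R.
  move=> m y z Ryz; rewrite /R -!YmodZ_shiftE -Ryz.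
  exact: fact.
have [H RH] := relation_sft ws Rtotal Rfun (graph_closed ws fc) Rshift Rsat.
pose h := CodeSeq.code [seq CodeSeq.code w | w <- H].
have WH : wordlist h = H by exact: wordlist_code.
pose r := related_config (M := M) pair_code
  (alph P1) (forbidden_words P1) (alph P2) (forbidden_words P2) (wordlist h).
have rR y z : R y z -> r (nconf y) (nconf z).
  by move=> /RH; rewrite -WH => Hyz; split; try exact: nconf_in_shift.
have Rr x x' : r x x' -> exists y z, [/\ nconf y = x, nconf z = x' & R y z].
  move=> [/nconf_surj[y <-] /nconf_surj[z <-]]; rewrite WH => /RH Ryz.
  by exists y, z.
set k := (c1 + c2 + h)%N.
have [c1k c2k] : (c1 <= k)%N /\ (c2 <= k)%N by rewrite /k; split; lia.
have [||m1 [m1' [N1 C1]]] := @half_check_complete M ws P1 P2 pair_code h k c2k.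
- move=> x /nconf_surj[y <-]; have [z Ryz] := Rtotal y.
  by exists (nconf z); exact: rR.
- move=> x x' z z' /Rr[y1 [z1 [<- <- R1]]] /Rr[y2 [z2 [<- <- R2]]] /class_of_eq E.
  by apply/class_of_eq; exact: Rfun R1 R2 E.
have [||m2 [m2' [N2 C2]]] :=
  @half_check_complete M ws P2 P1 (fun a b => pair_code b a) h k c1k.
- move=> x /nconf_surj[z <-]; have [y Ey] := class_of_surj (g (class_of z)).
  exists (nconf y); apply/related_config_swap/rR.
  by rewrite /R Ey gK.
- move=> x x' z z' /related_config_swap/Rr[y1 [z1 [<- <- R1]]].
  move=> /related_config_swap/Rr[y2 [z2 [<- <- R2]]] /class_of_eq E.
  apply/class_of_eq; apply: (can_inj fK).
  by rewrite [LHS]R1 [RHS]R2.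
exists (CodeSeq.code [:: h; m1; m1'; N1; m2; m2'; N2]).
by rewrite /check /letter CodeSeq.codeK /= C1 C2.
Qed.

End Main.

Lemma conjugate_sym (M : nmodType) (X Y : msystem M) : conjugate X Y -> conjugate Y X.
Proof.
move=> [f [g [fK gK fc gc fact]]]; exists g, f; split=> // m y.
by apply: (can_inj fK); rewrite fact !gK.
Qed.

Lemma conjugate_trans (M : nmodType) (Y X Z : msystem M) :
  conjugate X Y -> conjugate Y Z -> conjugate X Z.
Proof.
move=> [f [g [fK gK fc gc fact]]] [f' [g' [fK' gK' fc' gc' fact']]].
exists (f' \o f), (g \o g'); split=> [x|z|x|z|m x] /=.
- by rewrite fK' fK.
- by rewrite gK gK'.
- by apply: continuous_comp; [exact: fc | exact: fc'].
- by apply: continuous_comp; [exact: gc' | exact: gc].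
- by rewrite fact fact'.
Qed.

Lemma conjugacy_semidecidable (M : pzSemiRingType) (ws : windows M) :
  exists e : recfun,
  forall (P1 P2 : presentation M) (X1 X2 : msystem M),
    conjugate X1 (system_of P1) -> conjugate X2 (system_of P2) ->
    (halts e [:: code_presentation P1; code_presentation P2] <-> conjugate X1 X2).
Proof.
have [e He] := check_semidecidable (win_left ws); exists e => P1 P2 X1 X2 C1 C2.
split=> [/He[t /check_sound C]|C].
  exact: conjugate_trans (conjugate_trans C1 C) (conjugate_sym C2).
apply/He/check_complete.
exact: conjugate_trans (conjugate_trans (conjugate_sym C1) C) C2.
Qed.

Theorem theorem1p8 :
  (exists e : recfun,
     forall (P1 P2 : presentation nat) (X1 X2 : msystem nat),
       conjugate X1 (system_of P1) -> conjugate X2 (system_of P2) ->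
       (halts e [:: code_presentation P1; code_presentation P2] <->
        conjugate X1 X2)) /\
  (exists e : recfun,
     forall (P1 P2 : presentation int) (X1 X2 : msystem int),
       conjugate X1 (system_of P1) -> conjugate X2 (system_of P2) ->
       (halts e [:: code_presentation P1; code_presentation P2] <->
        conjugate X1 X2)).
Proof.
by split; [exact: conjugacy_semidecidable nat_windows
          |exact: conjugacy_semidecidable int_windows].
Qed.
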